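(* Let $B\in\mathbb Z_{\ge1}$, $r,t>0$, and let $H^*$ be a minimizer of the functional $G$ (over all real sequences). For any linear estimator $\hat S^{(H)}_{t,T}$, $$\sup_{\mu\prec B}\mathbb E\big[|S_{t,T}-\hat S^{(H^* )}_{t,T}|^2\big]\le 6\sup_{\mu\prec B}\mathbb E\big[|S_{t,T}-\hat S^{(H)}_{t,T}|^2\big],$$ $$\sup_{1\prec\mu\prec B}\mathbb E\big[|S_{t,T}-\hat S^{(H^* )}_{t,T}|^2\big]\le 34\sup_{1\prec\mu\prec B}\mathbb E\big[|S_{t,T}-\hat S^{(H)}_{t,T}|^2\big].$$
   Context: Setting (Poissonized generalized unseen species problem). $\mathcal{S}$ is an at most countable set of species and $\mu$ is a probability measure on $2^{\mathcal S}$ supported on finite sets. $t,t'>0$, $r=t'/t$, $T=t+t'=(1+r)t$. Let $X_1,X_2,\dots$ be i.i.d. from $\mu$, and let $n\sim\mathrm{Poisson}(t)$, $m\sim\mathrm{Poisson}(t')$ be independent of each other and of the $X_i$. The first expedition observes $X_1,\dots,X_n$, the second $X_{n+1},\dots,X_{n+m}$. For $s\in\mathcal S$, $N_s$ (resp. $N_s'$) is the number of sets observed in the first (resp. second) expedition that contain $s$. $S_t=|\{s:N_s>0\}|$, $S_T=|\{s:N_s+N_s'>0\}|$, $S_{t,T}=S_T-S_t$. $\mu\prec B$ means $\mu(A)=0$ whenever $|A|>B$; $1\prec\mu$ means additionally $\mu(\emptyset)=0$. Suprema range over all such $\mu$ on all at most countable species sets $\mathcal S$. A linear estimator is one of the form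 $\hat S^{(H)}_{t,T}=\sum_{s\in\mathcal S}H(N_s)$ for a function $H:\mathbb Z_{\ge0}\to\mathbb R$ with $H(0)=0$ (which may depend on $r$ and $t$); write $H_i=H(i)$. Let $g_H(x)=\sum_{i=1}^\infty\frac{H_i}{i!}x^i$, and let $H^2$ be the element-wise square of $H$. Define $$Y_b=\Big(\max_{p\in[0,1]}\frac{e^{-pt}}{p}\big|1-e^{-rpt}-g_H(pt)\big|\Big)^2,\qquad Y_v=\max_{q\in[0,1]}\frac{e^{-qt}}{q}\big(1-e^{-rqt}+g_{H^2}(qt)\big),\qquad G(H)=Y_b+Y_v,$$ where both expressions are extended continuously at zero (values $t|r-H_1|$ at $p=0$ and $t(r+H_1^2)$ at $q=0$), and $G(H)=+\infty$ if $\sum_{i\ge1}H_i^2t^i/i!=\infty$. A minimizer of $G$ exists for all $r,t>0$. *)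

(* Defs.v *)
From HB Require Import structures.
From mathcomp Require Import all_boot all_order all_algebra finmap.
From mathcomp Require Import all_classical all_reals all_analysis.

Set Implicit Arguments.
Unset Strict Implicit.
Unset Printing Implicit Defensive.

Import Order.TTheory GRing.Theory Num.Theory.
Import numFieldNormedType.Exports.

Local Open Scope classical_set_scope.
Local Open Scope ring_scope.

(* A probability measure on 2^S supported on finite sets is represented as a
   probability measure on {fset S}.  As S is countable, so is {fset S}, and the
   trace on it of the product sigma-algebra of 2^S is its full power set. *)
HB.instance Definition _ (S : countType) :=
  @isMeasurable.Build default_measure_display {fset S}
    discrete_measurable discrete_measurable0
    (@discrete_measurableC {fset S}) (@discrete_measurableU {fset S}).

Section model.
Context (R : realType) (S : countType).
Implicit Types mu : probability {fset S} R.

(* A realization of the Poissonized two-expedition experiment.  The sequence is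
   indexed from 0: [pm_X i] is the sample usually written X_{i+1}.  As the events
   A, B and C i may be the full sets, [pm_indep] is the product rule over every
   finite subfamily, i.e. mutual independence of n, m, X_1, X_2, ... *)
Record poisson_model mu (t t' : R) := PoissonModel {
  pm_disp : measure_display ;
  pm_Omega : measurableType pm_disp ;
  pm_P : probability pm_Omega R ;
  pm_X : nat -> {RV pm_P >-> {fset S}} ;
  pm_n : {RV pm_P >-> nat} ;
  pm_m : {RV pm_P >-> nat} ;
  pm_X_law : forall i (C : set {fset S}), distribution pm_P (pm_X i) C = mu C ;
  pm_n_law : forall k,
    distribution pm_P pm_n [set k] = (poisson_pmf t k)%:E ;
  pm_m_law : forall k,
    distribution pm_P pm_m [set k] = (poisson_pmf t' k)%:E ;
  pm_indep : forall (A B : set nat) (C : nat -> set {fset S}) (k : nat),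
    pm_P (pm_n @^-1` A `&` pm_m @^-1` B `&`
          \bigcap_(i < k) (pm_X i @^-1` C i)) =
    (pm_P (pm_n @^-1` A) * pm_P (pm_m @^-1` B) *
     \prod_(i < k) pm_P (pm_X i @^-1` C i))%E }.

Section observables.
Context (mu : probability {fset S} R) (t t' : R) (M : poisson_model mu t t').
Implicit Types w : pm_Omega M.

Definition count_first w (s : S) : nat :=
  (\sum_(0 <= i < pm_n M w) (s \in pm_X M i w))%N.

Definition count_second w (s : S) : nat :=
  (\sum_(pm_n M w <= i < pm_n M w + pm_m M w) (s \in pm_X M i w))%N.

(* The sets below are finite, so [fset_set] does not degenerate to [fset0]. *)
Definition seen_first w : nat :=
  #|` fset_set [set s : S | (0 < count_first w s)%N] |.

Definition seen_total w : nat :=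
  #|` fset_set [set s : S | (0 < count_first w s + count_second w s)%N] |.

Definition new_species w : R := (seen_total w)%:R - (seen_first w)%:R.

(* A sum over the finite support of the summand: it is finite when H 0 = 0. *)
Definition linear_estimator (H : nat -> R) w : R :=
  \sum_(s \in [set: S]) H (count_first w s).

Definition mse (H : nat -> R) : \bar R :=
  ('E_(pm_P M)[(fun w => `|new_species w - linear_estimator H w| ^+ 2)%R])%E.

End observables.

Definition sample_card_le (B : nat) mu : Prop :=
  forall A : {fset S}, (B < #|` A|)%N -> mu [set A] = 0%E.

Definition sample_nonempty mu : Prop := mu [set fset0] = 0%E.

End model.

(* The supremum ranges over all realizations of the experiment as well; the mean
   square error depends on mu only. *)
Definition sup_mse (R : realType)
    (Q : forall S : countType, probability {fset S} R -> Prop)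
    (t t' : R) (H : nat -> R) : \bar R :=
  ereal_sup [set e : \bar R | exists (S : countType)
    (mu : probability {fset S} R) (M : poisson_model mu t t'),
    Q S mu /\ e = mse M H].

Section functional.
Context (R : realType) (r t : R).
Implicit Types (H : nat -> R) (x p q : R).

Definition gen_fun H x : R :=
  limn (fun n => \sum_(1 <= i < n) H i / i`!%:R * x ^+ i).

Definition bias_at H p : R :=
  if p == 0 then t * `|r - H 1%N|
  else expR (- (p * t)) / p *
       `|1 - expR (- (r * p * t)) - gen_fun H (p * t)|.

Definition var_at H q : R :=
  if q == 0 then t * (r + H 1%N ^+ 2)
  else expR (- (q * t)) / q *
       (1 - expR (- (r * q * t)) + gen_fun (fun i => H i ^+ 2) (q * t)).

(* Under the summability condition of [G_fun] both functions are continuous on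
   [0, 1], so the suprema are maxima. *)
Definition Y_b H : \bar R :=
  (ereal_sup [set (bias_at H p)%:E | p in `[0%R, 1%R]] ^+ 2)%E.

Definition Y_v H : \bar R :=
  ereal_sup [set (var_at H q)%:E | q in `[0%R, 1%R]].

Definition G_fun H : \bar R :=
  if (\sum_(1 <= i <oo) (H i ^+ 2 * t ^+ i / i`!%:R)%:E == +oo)%E then +oo%E
  else (Y_b H + Y_v H)%E.

Definition G_minimizer H : Prop :=
  H 0%N = 0 /\ forall K : nat -> R, K 0%N = 0 -> (G_fun H <= G_fun K)%E.

End functional.

(* Main.v *)
Require Import Defs.
From HB Require Import structures.
From mathcomp Require Import all_boot all_order all_algebra finmap.
From mathcomp Require Import all_classical all_reals all_analysis.
From mathcomp Require Import measurable_realfun zify ring lra.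
Set Implicit Arguments.
Unset Strict Implicit.
Unset Printing Implicit Defensive.
Import Order.TTheory GRing.Theory Num.Theory.
Import numFieldNormedType.Exports.
Local Open Scope classical_set_scope.
Local Open Scope ring_scope.

(** The functional [G] is the worst mean square error divided by [B ^ 2], up to
    a constant factor: [sup mse(K) <= B^2 G(K)] and [B^2 G(K) <= c sup mse(K)]
    for every [K], with [c = 6] without and [c = 20] with the constraint that
    samples are nonempty.  A minimizer of [G] is therefore within the factor [c]
    of every [H], and [20 <= 34].

    The error of a linear estimator is a sum over the species of
    [D_s = 1{N_s = 0, N'_s > 0} - H(N_s)].  A species of probability [p] has
    [E D_s = p b(p)] and [E D_s^2 = p v(p)], where [|b|] and [v] are the functions
    whose maxima define [Y_b] and [Y_v] ([bias_mean] is [p b(p)] and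
    [second_mean] is [p v(p)]).

    Upper bound.  The numbers of samples equal to a given set are independent
    over all sets ([splitting]), and [D_s] depends only on the numbers for the
    sets that contain [s].  Revealing these numbers one by one decomposes the
    variance of [\sum_s D_s] into orthogonal increments, and each increment
    involves at most [B] species; hence [E (\sum D_s)^2] is at most
    [(\sum E D_s)^2 + B \sum E D_s^2] ([second_moment_sum_le]).  As the
    probabilities of the species add up to at most [B], this is at most
    [B^2 (Y_b + Y_v)] ([mse_upper]).  The argument is run on finitely many
    species with [H] cut off at a level [L]: everything then is a function of
    finitely many truncated counts, so that only finite sums occur.  Fatou's
    lemma removes the truncation.

    Lower bound.  For [B] inseparable copies of each of finitely many disjoint
    species of probabilities [p_j] the mean square error is exactly
    [B^2 ((\sum_j p_j b(p_j))^2 + \sum_j (p_j v(p_j) - p_j^2 b(p_j)^2))]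
    ([group_mse]).  Let [M] be the supremum of this divided by [B^2].  With
    [k] species of the same probability [p], [k] the integral part of [1/p], so
    that [1/2 < k p <= 1], one gets [b(p)^2 <= 4 M] and [v(p) <= 2 M]
    ([functional_le_any]).  If the samples have to be nonempty the remaining
    probability [q = 1 - k p] must be spent as well.  Then
    [k p |b(p)| <= sqrt M + q |b(q)|], and the species [q, q, 1 - 2 q] give
    [2 q |b(q)| <= sqrt M + (1 - 2 q) sup |b|]; together these force
    [sup |b| <= 3 sqrt M], and [v(p) <= 11 M] follows
    ([functional_le_nonempty]).  The values of [b] and [v] at [0] are limits
    ([bias_at_zero], [var_at_zero]).

    For the lower bound the experiment has to be realized on some probability
    space.  A point of the unit interval is decomposed into the index of the
    block that contains it and its relative position in that block; the two are
    independent and the position is again uniform ([unit_prob_split]), so this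
    can be iterated. *)

(** * Finite product probability spaces *)

Lemma sqr_sum_le (R : realType) (I : finType) (A : {pred I}) (y : I -> R) :
  (\sum_(i in A) y i) ^+ 2 <= #|A|%:R * \sum_(i in A) y i ^+ 2.
Proof.
have h : 0 <= \sum_(i in A) \sum_(j in A) (y i - y j) ^+ 2.
  by apply: sumr_ge0 => i _; apply: sumr_ge0 => j _; exact: sqr_ge0.
have : \sum_(i in A) \sum_(j in A) (y i - y j) ^+ 2 =
    2 * (#|A|%:R * \sum_(i in A) y i ^+ 2) - 2 * (\sum_(i in A) y i) ^+ 2.
  transitivity (\sum_(i in A) (#|A|%:R * y i ^+ 2 + \sum_(j in A) y j ^+ 2
      - 2 * (y i * \sum_(j in A) y j))).
    apply: eq_bigr => i _; rewrite !mulr_sumr -sumr_const mulr_suml.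
    rewrite -!big_split /= -sumrB; apply: eq_bigr => j _; ring.
  rewrite sumrB big_split /= -!mulr_sumr -!mulr_suml sumr_const -mulr_natl; ring.
lra.
Qed.

Section product_space.
Context (R : realType) (J V I : finType) (pi : J -> V -> R).
Hypothesis pi_ge0 : forall j v, 0 <= pi j v.
Hypothesis pi_sum1 : forall j, \sum_v pi j v = 1.
Implicit Types (f g : {ffun J -> V} -> R) (x : {ffun J -> V}).

Definition weight x : R := \prod_j pi j (x j).

Definition expect f : R := \sum_x weight x * f x.

Definition subst x (a : J) (v : V) : {ffun J -> V} :=
  [ffun j => if j == a then v else x j].

(** The conditional expectation of [f] given all coordinates but [a]. *)
Definition average (a : J) f x : R := \sum_v pi a v * f (subst x a v).

Lemma weight_ge0 x : 0 <= weight x.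
Proof. exact: prodr_ge0. Qed.

Lemma weight_sum1 : \sum_x weight x = 1.
Proof.
rewrite /weight -(bigA_distr_bigA pi) big1 // => j _; exact: pi_sum1.
Qed.

Lemma subst_same x a v w : subst (subst x a v) a w = subst x a w.
Proof. by apply/ffunP => j; rewrite !ffunE; case: eqP. Qed.

Lemma subst_swap x a b v w :
  a != b -> subst (subst x a v) b w = subst (subst x b w) a v.
Proof.
move=> ab; apply/ffunP => j; rewrite !ffunE; case: (eqVneq j b) => // ->.
by rewrite eq_sym (negbTE ab).
Qed.

Lemma subst_id x a : subst x a (x a) = x.
Proof. by apply/ffunP => j; rewrite !ffunE; case: eqP => // ->. Qed.

Lemma weight_subst x a v :
  weight x * pi a v = weight (subst x a v) * pi a (x a).
Proof.
rewrite /weight (bigD1 a) //= [in RHS](bigD1 a) //= !ffunE eqxx.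
have -> : \prod_(i | i != a) pi i (subst x a v i) = \prod_(i | i != a) pi i (x i).
  by apply: eq_bigr => i /negbTE ia; rewrite ffunE ia.
ring.
Qed.

Lemma expectD f g : expect (fun x => f x + g x) = expect f + expect g.
Proof. by rewrite /expect -big_split; apply: eq_bigr => x _; rewrite mulrDr. Qed.

Lemma expectZ c f : expect (fun x => c * f x) = c * expect f.
Proof. by rewrite /expect mulr_sumr; apply: eq_bigr => x _; rewrite mulrCA. Qed.

Lemma expectB f g : expect (fun x => f x - g x) = expect f - expect g.
Proof. by rewrite /expect -sumrB; apply: eq_bigr => x _; rewrite mulrBr. Qed.

Lemma expect_sum (K : finType) (A : {pred K}) (f : K -> {ffun J -> V} -> R) :
  expect (fun x => \sum_(k in A) f k x) = \sum_(k in A) expect (f k).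
Proof.
by rewrite /expect exchange_big; apply: eq_bigr => x _; rewrite mulr_sumr.
Qed.

Lemma expect_le f g : (forall x, f x <= g x) -> expect f <= expect g.
Proof. by move=> fg; apply: ler_sum => x _; rewrite ler_wpM2l ?weight_ge0. Qed.

Lemma expect_cst c : expect (fun=> c) = c.
Proof. by rewrite /expect -mulr_suml weight_sum1 mul1r. Qed.

(** Exchanging the value of the coordinate [a] with the fresh value drawn by
    the average is an involution that preserves the joint weight. *)
Lemma expect_average a f : expect (average a f) = expect f.
Proof.
pose swap (u : {ffun J -> V} * V) := (subst u.1 a u.2, u.1 a).
have swapK : involutive swap.
  by move=> [x v]; rewrite /swap /= subst_same subst_id ffunE eqxx.
transitivity (\sum_u weight u.1 * pi a u.2 * f (subst u.1 a u.2)).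
  rewrite /expect.
  transitivity (\sum_x \sum_v weight x * pi a v * f (subst x a v)).
    by apply: eq_bigr => x _; rewrite mulr_sumr; apply: eq_bigr => v _; rewrite mulrA.
  by rewrite pair_big.
rewrite (reindex_inj (inv_inj swapK)) /=.
transitivity (\sum_x \sum_v weight x * pi a v * f x).
  rewrite pair_big /=; apply: eq_bigr => -[x v] _ /=.
  by rewrite subst_same subst_id -weight_subst.
by apply: eq_bigr => x _; rewrite -mulr_suml -mulr_sumr pi_sum1 mulr1.
Qed.

(** Independence of the coordinate [a], stated as invariance so that averaging
    preserves it. *)
Definition free_of a f := forall x v, f (subst x a v) = f x.

Lemma average_free a f x : free_of a f -> average a f x = f x.
Proof.
move=> fa; rewrite /average -[RHS]mul1r -(pi_sum1 a) mulr_suml.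
by apply: eq_bigr => v _; rewrite fa.
Qed.

Lemma free_average a b f : free_of a f -> free_of a (average b f).
Proof.
move=> fa x v; apply: eq_bigr => w _; congr (_ * _).
by have [<-|ab] := eqVneq a b; rewrite ?subst_same // subst_swap // fa.
Qed.

Lemma average_is_free a f : free_of a (average a f).
Proof. by move=> x v; apply: eq_bigr => w _; rewrite subst_same. Qed.

Definition averages (l : seq J) f := foldl (fun g a => average a g) f l.

Lemma free_averages l a f : free_of a f \/ a \in l -> free_of a (averages l f).
Proof.
elim: l f => [|b l IH] f /=; first by case.
move=> h; apply: IH; rewrite in_cons in h.
case: h => [fa|/orP[/eqP ->|al]]; [left|left|by right].
- exact: free_average.
- exact: average_is_free.
Qed.

Lemma expect_averages l f : expect (averages l f) = expect f.
Proof. by elim: l f => //= a l IH f; rewrite IH expect_average. Qed.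

Lemma constant_of_free f : (forall a, free_of a f) -> forall x y, f x = f y.
Proof.
move=> fr x y.
suff h (l : seq J) : f x = f [ffun j => if j \in l then y j else x j].
  rewrite (h (enum J)); congr (f _); apply/ffunP => j.
  by rewrite ffunE mem_enum.
elim: l => [|a l IH].
  by congr (f _); apply/ffunP => j; rewrite ffunE in_nil.
rewrite IH -(fr a _ (y a)); congr (f _); apply/ffunP => j.
by rewrite !ffunE in_cons; case: eqP => [->|].
Qed.

Lemma averages_expect f x : averages (enum J) f x = expect f.
Proof.
rewrite -(expect_averages (enum J)) -[LHS]expect_cst; apply: eq_bigr => y _.
congr (_ * _); apply: constant_of_free => a.
by apply: free_averages; right; rewrite mem_enum.
Qed.

(** Averaging over a coordinate acts on only one of the two factors. *)
Lemma expectM_free f g : (forall a, free_of a f \/ free_of a g) ->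
  expect (fun x => f x * g x) = expect f * expect g.
Proof.
move=> fg.
have h l : expect (fun x => f x * g x) =
    expect (fun x => averages l f x * g x).
  elim: l f fg => //= a l IH f fg.
  have e : expect (fun x => f x * g x) = expect (fun x => average a f x * g x).
    have [fa|ga] := fg a.
      by apply: eq_bigr => x _; rewrite average_free.
    rewrite -(expect_average a); apply: eq_bigr => x _; congr (_ * _).
    by rewrite /average mulr_suml; apply: eq_bigr => v _; rewrite ga mulrA.
  rewrite e; apply: IH => b; have [fb|gb] := fg b; [left|by right].
  exact: free_average.
rewrite (h (enum J)) -expectZ; apply: eq_bigr => x _.
by rewrite averages_expect.
Qed.

Lemma average_sum (D : I -> {ffun J -> V} -> R) a x :
  average a (fun y => \sum_i D i y) x = \sum_i average a (D i) x.
Proof.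
rewrite /average exchange_big; apply: eq_bigr => v _; exact: mulr_sumr.
Qed.

Lemma local_variance a f x :
  average a (fun y => f y ^+ 2) x - average a f x ^+ 2 =
  \sum_v pi a v * (f (subst x a v) - average a f x) ^+ 2.
Proof.
set m := average a f x.
transitivity (\sum_v (pi a v * f (subst x a v) ^+ 2
   - 2 * m * (pi a v * f (subst x a v)) + pi a v * m ^+ 2)); last first.
  by apply: eq_bigr => v _; ring.
rewrite big_split sumrB /= -mulr_sumr -mulr_suml pi_sum1 -/(average a f x) -/m.
rewrite /average; ring.
Qed.

Context (B : nat) (D : I -> {ffun J -> V} -> R) (T : I -> {pred J}).

(** Only the terms that depend on the coordinate [a] contribute to the local
    variance of the sum, and there are at most [B] of them. *)
Lemma local_variance_sum a x : (#|[pred i | a \in T i]| <= B)%N ->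
    (forall i, a \notin T i -> free_of a (D i)) ->
  average a (fun y => (\sum_i D i y) ^+ 2) x -
    average a (fun y => \sum_i D i y) x ^+ 2 <=
  B%:R * \sum_i (average a (fun y => D i y ^+ 2) x - average a (D i) x ^+ 2).
Proof.
move=> hB hT; rewrite local_variance.
under [X in _ <= _ * X]eq_bigr do rewrite local_variance.
rewrite exchange_big mulr_sumr /=; apply: ler_sum => v _.
rewrite -mulr_sumr [leRHS]mulrCA ler_wpM2l //.
rewrite average_sum -sumrB.
rewrite (bigID [pred i | a \in T i]) /= [X in _ + X]big1 ?addr0; last first.
  by move=> i /hT fi; rewrite fi average_free // subrr.
apply: (le_trans (sqr_sum_le _ _)).
apply: ler_pM; rewrite ?ler0n ?ler_nat //.
  by apply: sumr_ge0 => i _; exact: sqr_ge0.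
rewrite [leRHS](bigID [pred i | a \in T i]) /= lerDl.
by apply: sumr_ge0 => i _; exact: sqr_ge0.
Qed.

End product_space.

Section variance_bound.
Context (R : realType) (J V I : finType) (pi : J -> V -> R).
Hypothesis pi_ge0 : forall j v, 0 <= pi j v.
Hypothesis pi_sum1 : forall j, \sum_v pi j v = 1.
Context (B : nat) (T : I -> {pred J}).
Hypothesis T_le : forall a, (#|[pred i | a \in T i]| <= B)%N.

Lemma averages_variance (l : seq J) (D : I -> {ffun J -> V} -> R) :
    (forall i a, a \notin T i -> free_of a (D i)) ->
  expect pi (fun x => (\sum_i D i x) ^+ 2) -
    expect pi (fun x => (\sum_i averages pi l (D i) x) ^+ 2) <=
  B%:R * \sum_i (expect pi (fun x => D i x ^+ 2)
                 - expect pi (fun x => averages pi l (D i) x ^+ 2)).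
Proof.
elim: l D => [|a l IH] D DT /=.
  by rewrite subrr big1 ?mulr0 // => i _; rewrite subrr.
have DT' i b : b \notin T i -> free_of b (average pi a (D i)).
  by move=> /DT; exact: free_average.
have := IH _ DT'.
set X := expect pi (fun x => (\sum_i averages pi l _ x) ^+ 2).
have := expect_le pi_ge0
  (fun x => local_variance_sum pi_ge0 pi_sum1 x (T_le a) (fun i => @DT i a)).
have e f : expect pi (fun x => average pi a f x) = expect pi f.
  exact: expect_average.
rewrite expectB expectZ e expect_sum.
under [X in _ <= _ * X]eq_bigr do rewrite expectB e.
have -> : expect pi (fun x => average pi a (fun y => \sum_i D i y) x ^+ 2) =
    expect pi (fun x => (\sum_i average pi a (D i) x) ^+ 2).
  by apply: eq_bigr => x _; rewrite average_sum.
rewrite !sumrB !mulrBr; lra.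
Qed.

(** Revealing the coordinates one at a time decomposes the second moment into
    orthogonal increments; a coordinate moves at most [B] of the summands. *)
Lemma second_moment_sum_le (D : I -> {ffun J -> V} -> R) :
    (forall i a, a \notin T i -> free_of a (D i)) ->
  expect pi (fun x => (\sum_i D i x) ^+ 2) <=
  (\sum_i expect pi (D i)) ^+ 2
  + B%:R * \sum_i expect pi (fun x => D i x ^+ 2).
Proof.
move=> DT; have := averages_variance (enum J) DT.
have -> : expect pi (fun x => (\sum_i averages pi (enum J) (D i) x) ^+ 2) =
    (\sum_i expect pi (D i)) ^+ 2.
  rewrite -[RHS](expect_cst pi_sum1); apply: eq_bigr => x _.
  by congr (_ * _ ^+ 2); apply: eq_bigr => i _; rewrite averages_expect.
rewrite lerBlDl => /le_trans; apply; rewrite lerD2l ler_wpM2l //.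
apply: ler_sum => i _; rewrite gerBl.
apply: sumr_ge0 => x _; rewrite mulr_ge0 ?sqr_ge0 //; exact: weight_ge0.
Qed.

End variance_bound.

(** Expand the mean of [(f - E f)^2]. *)
Lemma expect_sqr_le (R : realType) (J V : finType) (pi : J -> V -> R)
    (f : {ffun J -> V} -> R) :
  (forall j v, 0 <= pi j v) -> (forall j, \sum_v pi j v = 1) ->
  expect pi f ^+ 2 <= expect pi (fun x => f x ^+ 2).
Proof.
move=> pi0 pi1; set e := expect pi f.
have : 0 <= expect pi (fun x => (f x - e) ^+ 2).
  by apply: sumr_ge0 => x _; rewrite mulr_ge0 ?sqr_ge0 // weight_ge0.
have -> : expect pi (fun x => (f x - e) ^+ 2) =
    expect pi (fun x => f x ^+ 2) - e ^+ 2.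
  transitivity (expect pi (fun x => (f x ^+ 2 - (2 * e) * f x) + e ^+ 2)).
    by apply: eq_bigr => x _; congr (_ * _); ring.
  rewrite expectD expectB expectZ expect_cst // -/e; ring.
by rewrite subr_ge0.
Qed.

(** * Discrete random variables *)

Section discrete_variables.
Context d (Om : measurableType d).

(** Measurability into the full power set: any function of such a variable has
    the same property, and pairing and random indexing preserve it when the
    values are countable. *)
Definition discrete_rv (T : Type) (Z : Om -> T) :=
  forall A : set T, measurable (Z @^-1` A).

Lemma discrete_rv_fibres (T : countType) (Z : Om -> T) :
  (forall z, measurable (Z @^-1` [set z])) -> discrete_rv Z.
Proof.
move=> mZ A.
have -> : Z @^-1` A = \bigcup_k (if choice.unpickle k is Some z then
    if `[< A z >] then Z @^-1` [set z] else set0 else set0).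
  apply/seteqP; split => [w /= Aw|w [k _]].
    by exists (choice.pickle (Z w)) => //; rewrite choice.pickleK; case: asboolP.
  by case: choice.unpickle => // z; case: asboolP => //= Az ->.
apply: bigcupT_measurable => k; case: choice.unpickle => [z|]; last exact: measurable0.
by case: ifP => // _; exact: measurable0.
Qed.

Lemma discrete_rv_comp (T U : Type) (Z : Om -> T) (f : T -> U) :
  discrete_rv Z -> discrete_rv (fun w => f (Z w)).
Proof. by move=> mZ A; exact: (mZ (f @^-1` A)). Qed.

Lemma discrete_rv_cst (T : Type) (c : T) : discrete_rv (fun=> c).
Proof. by move=> A; rewrite preimage_cst; case: ifP. Qed.

Lemma discrete_rv_pair (T U : countType) (Z : Om -> T) (Z' : Om -> U) :
  discrete_rv Z -> discrete_rv Z' -> discrete_rv (fun w => (Z w, Z' w)).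
Proof.
move=> mZ mZ'; apply: discrete_rv_fibres => -[z z'].
have -> : (fun w => (Z w, Z' w)) @^-1` [set (z, z')] =
    Z @^-1` [set z] `&` Z' @^-1` [set z'].
  by apply/seteqP; split => w /= [-> ->].
exact: measurableI.
Qed.

Lemma discrete_rv_ffun (J : finType) (T : countType) (Z : J -> Om -> T) :
  (forall j, discrete_rv (Z j)) -> discrete_rv (fun w => [ffun j => Z j w]).
Proof.
move=> mZ; apply: discrete_rv_fibres => z.
have -> : (fun w => [ffun j => Z j w]) @^-1` [set z] =
    \big[setI/setT]_(j <- enum J) (Z j @^-1` [set z j]).
  rewrite -bigcap_seq; apply/seteqP; split => w /=.
    by move=> <- j _ /=; rewrite ffunE.
  by move=> h; apply/ffunP => j; rewrite ffunE; apply: h; rewrite /= mem_enum.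
by apply: bigsetI_measurable => j _; exact: mZ.
Qed.

Lemma discrete_rv_bind (T : countType) (U : Type) (Z : Om -> T)
    (F : T -> Om -> U) :
  discrete_rv Z -> (forall z, discrete_rv (F z)) ->
  discrete_rv (fun w => F (Z w) w).
Proof.
move=> mZ mF A.
have -> : (fun w => F (Z w) w) @^-1` A = \bigcup_k
    (if choice.unpickle k is Some z then Z @^-1` [set z] `&` F z @^-1` A else set0).
  apply/seteqP; split => [w /= Aw|w [k _]].
    by exists (choice.pickle (Z w)) => //; rewrite choice.pickleK.
  by case: choice.unpickle => // z [/= ->].
apply: bigcupT_measurable => k; case: choice.unpickle => [z|]; last exact: measurable0.
by apply: measurableI; [exact: mZ|exact: mF].
Qed.

Lemma discrete_rv_sum (F : nat -> Om -> nat) (m n : nat) :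
  (forall i, discrete_rv (F i)) ->
  discrete_rv (fun w => (\sum_(m <= i < n) F i w)%N).
Proof.
move=> mF; elim: (index_iota m n) => [|i r IH].
  by under eq_fun do rewrite big_nil; exact: discrete_rv_cst.
under eq_fun do rewrite big_cons.
exact: (discrete_rv_comp (fun u => (u.1 + u.2)%N) (discrete_rv_pair (mF i) IH)).
Qed.

Lemma discrete_rv_measurable d' (U : measurableType d') (Z : Om -> U) :
  discrete_rv Z -> measurable_fun setT Z.
Proof. by move=> mZ _ A mA; rewrite setTI. Qed.

End discrete_variables.

Section finite_integral.
Context d (Om : measurableType d) (R : realType) (P : probability Om R).

Definition prob (A : set Om) : R := fine (P A).

Lemma probE A : measurable A -> P A = (prob A)%:E.
Proof. by move=> mA; rewrite /prob fineK // fin_num_measure. Qed.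

Lemma prob_ge0 A : 0 <= prob A.
Proof. by rewrite /prob fine_ge0. Qed.

Lemma prob_eq A r : P A = r%:E -> prob A = r.
Proof. by rewrite /prob => ->. Qed.

Lemma total_measure (T : finType) (Z : Om -> T) (E : set Om) :
  discrete_rv Z -> measurable E ->
  P E = (\sum_z P (E `&` Z @^-1` [set z]))%E.
Proof.
move=> mZ mE.
have {1}-> : E = \bigcup_(z in [set: T]) (E `&` Z @^-1` [set z]).
  by apply/seteqP; split => [w Ew|w [z _ []]//]; exists (Z w).
rewrite measure_fin_bigcup //; last 2 first.
- by move=> z z' _ _ [w [[_ /= <-] [_ /= <-]]].
- by move=> z _; apply: measurableI; [|exact: mZ].
rewrite (fsbigE (index_enum T)) ?index_enum_uniq //.
- by apply: eq_bigl => z; rewrite in_setT.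
- by move=> z _; rewrite mem_index_enum.
- exact: finite_finset.
Qed.

Lemma total_prob (T : finType) (Z : Om -> T) (E : set Om) :
  discrete_rv Z -> measurable E ->
  prob E = \sum_z prob (E `&` Z @^-1` [set z]).
Proof.
move=> mZ mE; apply: prob_eq; rewrite (total_measure mZ mE) -sumEFin.
by apply: eq_bigr => z _; rewrite probE //; exact: measurableI.
Qed.

Lemma integral_finite (T : finType) (Z : Om -> T) (phi : T -> R) :
  discrete_rv Z -> (forall z, 0 <= phi z) ->
  (\int[P]_w (phi (Z w))%:E =
   (\sum_z prob (Z @^-1` [set z]) * phi z)%:E)%E.
Proof.
move=> mZ phi0.
transitivity (\int[P]_w \sum_z (phi z * \1_(Z @^-1` [set z]) w)%:E)%E.
  apply: eq_integral => w _; rewrite sumEFin; congr EFin.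
  rewrite (bigD1 (Z w)) //= indicE mem_set // mulr1 big1 ?addr0 // => z zw.
  by rewrite indicE memNset ?mulr0 //= => e; rewrite e eqxx in zw.
rewrite ge0_integral_sum //.
- rewrite -sumEFin; apply: eq_bigr => z _.
  rewrite (integralZl_indic _ (fun=> Z @^-1` [set z])) //; last first.
    by rewrite ltNge phi0.
  by rewrite integral_indic // setIT EFinM muleC; congr (_ * _)%E; exact: probE.
- move=> z; apply/measurable_EFinP; apply: measurable_funM.
    exact: measurable_cst.
  exact/measurable_indic/mZ.
- by move=> z w _; rewrite lee_fin mulr_ge0.
Qed.

Lemma sum_law_comp (T U : finType) (Z : Om -> T) (g : T -> U) (phi : U -> R) :
  discrete_rv Z ->
  \sum_z prob (Z @^-1` [set z]) * phi (g z) =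
  \sum_u prob ((g \o Z) @^-1` [set u]) * phi u.
Proof.
move=> mZ; rewrite (partition_big g predT) //=; apply: eq_bigr => u _.
rewrite (total_prob mZ) ?mulr_suml; last exact: (discrete_rv_comp g mZ [set u]).
rewrite [RHS](bigID [pred z | g z == u]) /= [X in _ + X]big1 ?addr0; last first.
  move=> z /eqP gz; suff -> : (g \o Z) @^-1` [set u] `&` Z @^-1` [set z] = set0.
    by rewrite /prob measure0 mul0r.
  by apply/seteqP; split => // w [/= gw zw]; case: gz; rewrite -zw.
apply: eq_bigr => z /eqP gz; rewrite gz; congr (prob _ * _).
by apply/seteqP; split => [w /= ->|w []].
Qed.

End finite_integral.

(** * Splitting a Poissonized sample by letters *)

Section poisson_weights.
Context (R : realType).

(** Unlike [poisson_pmf], this is also the right law at rate [0]. *)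
Definition pois (lambda : R) (k : nat) : R :=
  expR (- lambda) * (lambda ^+ k / k`!%:R).

Lemma poisE (t : R) k : 0 < t -> poisson_pmf t k = pois t k.
Proof. by move=> t0; rewrite /poisson_pmf t0 /pois mulrC. Qed.

Lemma pois_ge0 (lambda : R) k : 0 <= lambda -> 0 <= pois lambda k.
Proof. by move=> l0; rewrite /pois mulr_ge0 ?expR_ge0 // divr_ge0 // exprn_ge0. Qed.

Lemma poisson_prob_set1 (lambda : R) k :
  0 <= lambda -> poisson_prob lambda 0 [set k] = (pois lambda k)%:E.
Proof.
rewrite /poisson_prob le_eqVlt => /orP[/eqP <-|l0]; last first.
  by rewrite l0 esum_set1 ?poisE // lee_fin pois_ge0 // ltW.
rewrite ltxx diracE /pois oppr0 expR0 mul1r expr0n.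
have [->|k0] := eqVneq k 0%N; first by rewrite mem_set // fact0 divr1.
rewrite memNset /= ?(negbTE k0) ?mul0r // => e.
by rewrite -e eqxx in k0.
Qed.

End poisson_weights.

Section splitting.
Context d (Om : measurableType d) (R : realType) (P : probability Om R).
Context (K : finType) (Y : nat -> Om -> K) (q : K -> R).
Hypothesis mY : forall i, discrete_rv (Y i).
Hypothesis law_Y : forall i a, P (Y i @^-1` [set a]) = (q a)%:E.

(** The event [A] is decided before time [l]: it is independent of the letters
    [Y l, Y l.+1, ...]. *)
Definition independent_from (l : nat) (A : set Om) : Prop :=
  measurable A /\ forall k (C : nat -> set K),
    P (A `&` \bigcap_(i < k) Y (l + i)%N @^-1` C i) =
    (P A * \prod_(i < k) P (Y (l + i)%N @^-1` C i))%E.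

Lemma independent_fromS l A C : independent_from l A ->
  P (A `&` Y l @^-1` C) = (P A * P (Y l @^-1` C))%E /\
  independent_from l.+1 (A `&` Y l @^-1` C).
Proof.
move=> [mA iA].
have e : P (A `&` Y l @^-1` C) = (P A * P (Y l @^-1` C))%E.
  have := iA 1%N (fun=> C); rewrite big_ord_recl big_ord0 mule1 addn0 => <-.
  congr (P (_ `&` _)); apply/seteqP; split => [w /= Cw i /=|w /(_ 0%N isT) /=].
    by rewrite ltnS leqn0 => /eqP ->; rewrite addn0.
  by rewrite addn0.
split=> //; split=> [|k D].
  by apply: measurableI => //; exact: mY.
rewrite e -muleA; have := iA k.+1 (fun i => if i is j.+1 then D j else C).
rewrite big_ord_recl addn0.
under eq_bigr do rewrite lift0 addnS -addSn.
move=> <-; congr (P _); apply/seteqP; split => w /= => [[[Aw Cw] Dw]|[Aw Dw]].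
  split=> // -[|i] /= ik; first by rewrite addn0.
  by rewrite addnS -addSn; exact: Dw.
split; first by split=> //; have := Dw 0%N isT; rewrite addn0.
by move=> i /= ik; rewrite addSn -addnS; exact: (Dw i.+1).
Qed.

Lemma independent_from0 l : independent_from l set0.
Proof.
by split=> [|k C]; [exact: measurable0|rewrite set0I measure0 mul0e].
Qed.

Lemma bigcapY_measurable l k (C : nat -> set K) :
  measurable (\bigcap_(i < k) Y (l + i)%N @^-1` C i).
Proof.
by rewrite bigcap_mkord; apply: bigsetI_measurable => i _; exact: mY.
Qed.

Lemma independent_from_union (T : finType) (Z : Om -> T) l A :
  discrete_rv Z -> measurable A ->
  (forall z, independent_from l (A `&` Z @^-1` [set z])) ->
  independent_from l A.
Proof.
move=> mZ mA iA; split=> // k C; set D := \bigcap_(i < k) _.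
have mD : measurable D by exact: bigcapY_measurable.
rewrite (total_measure P mZ); last exact: measurableI.
rewrite (total_measure P mZ mA) ge0_sume_distrl //.
by apply: eq_bigr => z _; rewrite setIAC; have [_ ->] := iA z.
Qed.

Definition counts (l n : nat) (w : Om) : {ffun K -> nat} :=
  [ffun a => (\sum_(l <= i < l + n) (Y i w == a))%N].

Definition one_less (k : {ffun K -> nat}) (a : K) : {ffun K -> nat} :=
  [ffun b => (k b - (b == a))%N].

Lemma counts0 l w : counts l 0 w = [ffun=> 0%N].
Proof. by apply/ffunP => a; rewrite !ffunE addn0 big_geq. Qed.

Lemma countsS l n w : counts l n.+1 w =
  [ffun a => (counts l.+1 n w a + (a == Y l w))%N].
Proof.
apply/ffunP => a; rewrite !ffunE big_ltn ?addnS ?ltnS ?leq_addr //.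
by rewrite addSn addnC eq_sym.
Qed.

Lemma discrete_counts l n : discrete_rv (counts l n).
Proof.
apply: discrete_rv_ffun => a; apply: discrete_rv_sum => i.
exact: (discrete_rv_comp (fun b => nat_of_bool (b == a)) (mY i)).
Qed.

Lemma sum_counts l n w : (\sum_a counts l n w a = n)%N.
Proof.
under eq_bigr do rewrite ffunE; rewrite exchange_big /=.
have e i : (\sum_a (Y i w == a))%N = 1%N.
  by rewrite (bigD1 (Y i w)) //= eqxx big1 // => a /negbTE; rewrite eq_sym => ->.
by under eq_bigr do rewrite e; rewrite sum_nat_const_nat muln1 addKn.
Qed.

(** [n!] times this is the multinomial probability of the counts [k], for
    [n = \sum_a k a]. *)
Definition multi_weight (k : {ffun K -> nat}) : R :=
  \prod_a (q a ^+ k a / (k a)`!%:R).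

Lemma multi_weight_one_less (k : {ffun K -> nat}) a : (0 < k a)%N ->
  q a * multi_weight (one_less k a) = (k a)%:R * multi_weight k.
Proof.
move=> ka; rewrite /multi_weight (bigD1 a) //= [in RHS](bigD1 a) //= !mulrA.
congr (_ * _); last first.
  by apply: eq_bigr => b /negbTE ba; rewrite ffunE ba subn0.
rewrite ffunE eqxx; case: (k a) ka => // c _.
rewrite subn1 /= exprS factS natrM.
have : c`!%:R != 0 :> R by rewrite pnatr_eq0 -lt0n fact_gt0.
have : c.+1%:R != 0 :> R by rewrite pnatr_eq0.
move: (c.+1%:R) (c`!%:R) => u v u0 v0; field; exact/andP.
Qed.

(** Conditioning on the first letter: with [n = \sum_a k_a] the multinomial
    weights satisfy [n! w(k) = \sum_a (n - 1)! q_a w(k - e_a)], because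
    [q_a w(k - e_a)] is [k_a w(k)]. *)
Lemma counts_law n l A (k : {ffun K -> nat}) :
  independent_from l A -> (\sum_a k a = n)%N ->
  independent_from (l + n) (A `&` counts l n @^-1` [set k]) /\
  P (A `&` counts l n @^-1` [set k]) =
    (P A * (n`!%:R * multi_weight k)%:E)%E.
Proof.
elim: n l A k => [|n IH] l A k iA kn.
  have k0 a : k a = 0%N.
    by apply/eqP; move/eqP: kn; rewrite sum_nat_eq0 => /forallP /(_ a).
  have -> : A `&` counts l 0 @^-1` [set k] = A.
    apply/seteqP; split=> [w []//|w Aw]; split=> //=.
    by rewrite counts0; apply/ffunP => a; rewrite ffunE k0.
  rewrite addn0; split=> //.
  rewrite /multi_weight big1 ?mulr1 ?mule1 // => a _.
  by rewrite k0 expr0 fact0 divr1.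
set E := A `&` _.
have mE : measurable E by apply: measurableI; [exact: iA.1|exact: discrete_counts].
have step a : independent_from (l + n.+1) (E `&` Y l @^-1` [set a]) /\
    P (E `&` Y l @^-1` [set a]) =
    (P A * (n`!%:R * (k a)%:R * multi_weight k)%:E)%E.
  have [ka|ka] := posnP (k a).
    have -> : E `&` Y l @^-1` [set a] = set0.
      apply/seteqP; split=> // w [[_ /= kw] Yw]; move: ka.
      by rewrite -kw countsS ffunE Yw eqxx addn1.
    rewrite measure0 ka mulr0 mul0r mule0; split=> //.
    exact: independent_from0.
  have -> : E `&` Y l @^-1` [set a] =
      (A `&` Y l @^-1` [set a]) `&` counts l.+1 n @^-1` [set (one_less k a)].
    apply/seteqP; split=> w /=.
      move=> [[Aw kw] Yw]; split=> //; rewrite -kw countsS.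
      by apply/ffunP => b; rewrite !ffunE Yw addnK.
    move=> [[Aw Yw] kw]; split=> //; split=> //=; rewrite countsS kw.
    apply/ffunP => b; rewrite !ffunE Yw subnK //.
    by case: eqP => // ->.
  have [e iA'] := independent_fromS [set a] iA.
  have kn' : (\sum_b one_less k a b = n)%N.
    apply/eqP; rewrite -eqSS -kn; apply/eqP.
    rewrite [in RHS](bigD1 a) //= (bigD1 a) //= ffunE eqxx subn1 -addSn prednK //.
    by congr (_ + _)%N; apply: eq_bigr => b /negbTE ba; rewrite ffunE ba subn0.
  have [i1 e1] := IH l.+1 _ (one_less k a) iA' kn'.
  rewrite addnS -addSn; split=> //.
  rewrite e1 e law_Y -muleA -EFinM; congr (_ * _%:E)%E.
  by rewrite mulrCA multi_weight_one_less // mulrA.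
split.
  by apply: (independent_from_union (mY l) mE) => a; exact: (step a).1.
rewrite (total_measure P (mY l) mE).
under eq_bigr do rewrite (step _).2.
rewrite -ge0_sume_distrr; last first.
  move=> a _; rewrite lee_fin mulr_ge0 // ?mulr_ge0 //.
  apply: prodr_ge0 => b _; rewrite divr_ge0 // exprn_ge0 // -lee_fin -(law_Y 0).
  exact: measure_ge0.
rewrite sumEFin; congr (_ * _%:E)%E; rewrite -mulr_suml -mulr_sumr -natr_sum kn.
by rewrite factS natrM; congr (_ * _); rewrite mulrC.
Qed.

Context (n m : Om -> nat) (t t' : R).
Hypotheses (mn : discrete_rv n) (mm : discrete_rv m).
Hypothesis rule : forall n0 m0 k (C : nat -> set K),
  P (n @^-1` [set n0] `&` m @^-1` [set m0] `&` \bigcap_(i < k) Y i @^-1` C i) =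
  ((pois t n0 * pois t' m0)%:E * \prod_(i < k) P (Y i @^-1` C i))%E.

Definition first_counts w : {ffun K -> nat} := counts 0 (n w) w.
Definition second_counts w : {ffun K -> nat} := counts (n w) (m w) w.

Lemma discrete_first_counts : discrete_rv first_counts.
Proof. apply: (discrete_rv_bind mn) => k; exact: discrete_counts. Qed.

Lemma discrete_second_counts : discrete_rv second_counts.
Proof.
have := discrete_rv_bind (discrete_rv_pair mn mm)
  (fun u => discrete_counts u.1 u.2).
exact.
Qed.

Lemma sum_law1 : \sum_a q a = 1.
Proof.
have := total_measure P (mY 0) measurableT; rewrite probability_setT.
under eq_bigr do rewrite setTI law_Y.
by rewrite sumEFin => -[].
Qed.

(** The total of the counts determines the Poisson number of letters, whose
    factor [n!] in the denominator cancels the one of the multinomial law. *)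
Lemma poisson_factor (s : R) (k : {ffun K -> nat}) :
  pois s (\sum_a k a)%N * (((\sum_a k a)%N)`!%:R * multi_weight k) =
  \prod_a pois (s * q a) (k a).
Proof.
rewrite /pois big_split /= -(big_morph expR (@expRD R) (@expR0 R)).
rewrite sumrN -mulr_sumr sum_law1 mulr1 -mulrA; congr (_ * _).
under [RHS]eq_bigr do rewrite exprMn -mulrA.
rewrite big_split /= -/(multi_weight k) mulrA divfK ?pnatr_eq0 -?lt0n ?fact_gt0 //.
by congr (_ * _); rewrite (big_morph _ (exprD s) (expr0 s)).
Qed.

(** The counts determine the numbers of samples in the two windows, so a single
    pair of Poisson numbers contributes to the event. *)
Lemma splitting (k k' : {ffun K -> nat}) :
  P (first_counts @^-1` [set k] `&` second_counts @^-1` [set k']) =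
  ((\prod_a pois (t * q a) (k a)) * (\prod_a pois (t' * q a) (k' a)))%:E.
Proof.
set n0 := (\sum_a k a)%N; set m0 := (\sum_a k' a)%N.
pose A := n @^-1` [set n0] `&` m @^-1` [set m0].
have PA : P A = (pois t n0 * pois t' m0)%:E.
  have := rule n0 m0 0 (fun=> setT).
  by rewrite big_ord0 mule1 => <-; rewrite bigcap_mkord big_ord0 setIT.
have iA : independent_from 0 A.
  split=> [|j C]; first by apply: measurableI; [exact: mn|exact: mm].
  by rewrite PA -rule; congr (P _).
have [i1 e1] := counts_law iA (erefl n0).
have [_ e2] := counts_law i1 (erefl m0).
have -> : first_counts @^-1` [set k] `&` second_counts @^-1` [set k'] =
    A `&` counts 0 n0 @^-1` [set k] `&` counts (0 + n0) m0 @^-1` [set k'].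
  rewrite add0n; apply/seteqP; split=> w /=; last first.
    by move=> [[[/= nw mw] kw] kw']; rewrite /first_counts /second_counts nw mw.
  move=> [kw kw'].
  have nw : n w = n0 by rewrite /n0 -kw sum_counts.
  have mw : m w = m0 by rewrite /m0 -kw' sum_counts.
  by split; [split|]; rewrite -?nw -?mw.
rewrite e2 e1 PA -!EFinM -!poisson_factor -/n0 -/m0; congr (_%:E); ring.
Qed.

End splitting.

(** * Independence of the cell counts *)

Section product_rule.
Context d (Om : measurableType d) (R : realType) (P : probability Om R).
Context (J : finType) (Z : J -> Om -> nat) (nu : J -> probability nat R).
Hypothesis mZ : forall j, discrete_rv (Z j).
Hypothesis pmf_rule : forall z : J -> nat,
  P [set w | forall j, Z j w = z j] = (\prod_j nu j [set z j])%E.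

Lemma joint_measurable (E : J -> set nat) :
  measurable [set w | forall j, E j (Z j w)].
Proof.
have := discrete_rv_ffun mZ (fun z : {ffun J -> nat} => forall j, E j (z j)).
congr measurable; apply/seteqP; split=> w /= Ew j; have := Ew j; by rewrite ffunE.
Qed.

Lemma measure_nat_series (m : {measure set nat -> \bar R}) (E : set nat) :
  m E = (\sum_(k <oo | k \in E) m [set k])%E.
Proof.
rewrite -measure_bigcup //; last by move=> i j _ _ [k [/= <- <-]].
by congr (m _); apply/seteqP; split=> [k Ek|_ [k Ek ->]] //; exists k.
Qed.

(** The product rule passes from points to arbitrary sets one coordinate at a
    time, by countable additivity. *)
Lemma product_rule (E : J -> set nat) :
  P [set w | forall j, E j (Z j w)] = (\prod_j nu j (E j))%E.
Proof.
suff h (l : seq J) : forall E' : J -> set nat,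
    (forall j, j \notin l -> exists k, E' j = [set k]) ->
    P [set w | forall j, E' j (Z j w)] = (\prod_j nu j (E' j))%E.
  by apply: (h (enum J)) => j; rewrite mem_enum.
elim: l => [|a l IH] {}E El.
  have /choice [z Ez] : forall j, exists k, E j = [set k] by move=> j; exact: El.
  under eq_bigr do rewrite Ez.
  by rewrite -pmf_rule; congr (P _); apply/seteqP; split=> w /= h j;
    have := h j; rewrite Ez.
pose Ek k j := if j == a then [set k] else E j.
have eEk k : P [set w | forall j, Ek k j (Z j w)] =
    (nu a [set k] * \prod_(j | j != a) nu j (E j))%E.
  rewrite IH => [|j jl]; last first.
    rewrite /Ek; case: eqP => [_|/eqP ja]; first by exists k.
    by apply: El; rewrite in_cons negb_or ja.
  rewrite (bigD1 a) //= /Ek eqxx; congr (_ * _)%E.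
  by apply: eq_bigr => j /negbTE ->.
have -> : [set w | forall j, E j (Z j w)] =
    \bigcup_(k in E a) [set w | forall j, Ek k j (Z j w)].
  apply/seteqP; split=> [w /= h|w [k /= kE h] j].
    by exists (Z a w) => //= j; rewrite /Ek; case: eqP => [->|].
  by have := h j; rewrite /Ek; case: eqP => [-> ->|].
rewrite measure_bigcup; last 2 first.
- by move=> k _; exact: joint_measurable.
- move=> i k _ _ [w [/= hi hk]].
  by have := hi a; have := hk a; rewrite /Ek eqxx => /= <- <-.
transitivity (\sum_(k <oo | k \in E a)
    (nu a [set k] * \prod_(j | j != a) nu j (E j)))%E.
  by apply: eq_eseriesr => k _; exact: eEk.
rewrite [RHS](bigD1 a) //= (measure_nat_series (nu a) (E a)).
have -> : (\prod_(j | j != a) nu j (E j))%E =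
    (\prod_(j | j != a) fine (nu j (E j)))%:E.
  by rewrite -prodEFin; apply: eq_bigr => j _; rewrite fineK // fin_num_measure.
rewrite muleC -nneseriesZl //; apply: eq_eseriesr => k _; exact: muleC.
Qed.

End product_rule.

Section truncation.
Context (R : realType) (L : nat).

(** Identifying all counts above [L] loses nothing for a score that is cut off
    at [L]. *)
Definition trunc (k : nat) : 'I_L.+2 := inord (minn k L.+1).

Lemma truncE k : trunc k = minn k L.+1 :> nat.
Proof. by rewrite inordK // ltnS geq_minr. Qed.

Definition trunc_pmf (nu : probability nat R) (v : 'I_L.+2) : R :=
  prob nu (trunc @^-1` [set v]).

Lemma trunc_pmf_ge0 nu v : 0 <= trunc_pmf nu v.
Proof. exact: prob_ge0. Qed.

Lemma trunc_pmf_sum1 nu : \sum_v trunc_pmf nu v = 1.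
Proof.
have mt : discrete_rv trunc by [].
have := total_prob nu mt measurableT; rewrite {1}/prob probability_setT => /esym.
by under eq_bigr do rewrite setTI.
Qed.

Lemma trunc_pmf_small nu (v : 'I_L.+2) :
  (v <= L)%N -> trunc_pmf nu v = prob nu [set (v : nat)].
Proof.
move=> vL; congr prob; apply/seteqP; split=> k /=.
  move=> /(congr1 val) /= e; move: vL; rewrite -e truncE; rewrite /minn.
  by case: ltnP => //; rewrite ltnn.
by move=> ->; apply/val_inj => /=; rewrite truncE; apply/minn_idPl/leqW.
Qed.

End truncation.

Section poissonized.
Context d (Om : measurableType d) (R : realType) (P : probability Om R).

(** An i.i.d. sequence of letters of which [n] are read in the first expedition
    and the next [m] in the second, for independent Poisson numbers [n], [m]. *)
Record poissonized (K : finType) (Y : nat -> Om -> K) (q : K -> R)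
    (n m : Om -> nat) (t t' : R) : Prop := Poissonized {
  letters_discrete : forall i, discrete_rv (Y i) ;
  letters_law : forall i a, P (Y i @^-1` [set a]) = (q a)%:E ;
  first_discrete : discrete_rv n ;
  second_discrete : discrete_rv m ;
  poissonized_rule : forall n0 m0 k (C : nat -> set K),
    P (n @^-1` [set n0] `&` m @^-1` [set m0] `&`
       \bigcap_(i < k) Y i @^-1` C i) =
    ((pois t n0 * pois t' m0)%:E * \prod_(i < k) P (Y i @^-1` C i))%E }.

Section one_alphabet.
Context (K : finType) (Y : nat -> Om -> K) (q : K -> R).
Context (n m : Om -> nat) (t t' : R).
Hypothesis sampling : poissonized Y q n m t t'.
Hypotheses (t0 : 0 <= t) (t'0 : 0 <= t').

Lemma letter_ge0 a : 0 <= q a.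
Proof. by rewrite -lee_fin -(letters_law sampling 0) measure_ge0. Qed.

Lemma letter_sum1 : \sum_a q a = 1.
Proof. exact: (sum_law1 (letters_discrete sampling) (letters_law sampling)). Qed.

(** The cells are pairs of a letter and an expedition, [false] for the first and
    [true] for the second. *)
Definition cell_count (j : K * bool) (w : Om) : nat :=
  if j.2 then second_counts Y n m w j.1 else first_counts Y n w j.1.

Definition cell_law (j : K * bool) : probability nat R :=
  poisson_prob ((if j.2 then t' else t) * q j.1) 0.

Lemma discrete_cell_count j : discrete_rv (cell_count j).
Proof.
case: sampling => mY _ mn mm _; case: j => a [].
  apply: (discrete_rv_comp (fun k : {ffun K -> nat} => k a)).
  exact: discrete_second_counts.
apply: (discrete_rv_comp (fun k : {ffun K -> nat} => k a)).
exact: discrete_first_counts.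
Qed.

Lemma cell_law_set1 j k :
  cell_law j [set k] = (pois ((if j.2 then t' else t) * q j.1) k)%:E.
Proof.
by apply: poisson_prob_set1; rewrite mulr_ge0 ?letter_ge0 //; case: ifP.
Qed.

Lemma cell_counts_product (E : K * bool -> set nat) :
  P [set w | forall j, E j (cell_count j w)] = (\prod_j cell_law j (E j))%E.
Proof.
apply: (product_rule discrete_cell_count) => z.
case: sampling => mY lY mn mm rule.
have := splitting mY lY mn mm rule [ffun a => z (a, false)] [ffun a => z (a, true)].
have -> : [set w | forall j, cell_count j w = z j] =
    first_counts Y n @^-1` [set [ffun a => z (a, false)]] `&`
    second_counts Y n m @^-1` [set [ffun a => z (a, true)]].
  apply/seteqP; split=> w /=.
    move=> h; split; apply/ffunP => a; rewrite ffunE.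
      exact: (h (a, false)).
    exact: (h (a, true)).
  by move=> [h1 h2] [a []]; rewrite /cell_count /= ?h1 ?h2 ffunE.
move=> ->; under [RHS]eq_bigr do rewrite cell_law_set1.
rewrite prodEFin -big_split /=; congr (_%:E).
transitivity (\prod_a \prod_(b : bool) pois ((if b then t' else t) * q a) (z (a, b))).
  apply: eq_bigr => a _.
  by rewrite big_bool /= !ffunE mulrC.
by rewrite pair_big /=; apply: eq_bigr => -[a b] _.
Qed.

Context (L : nat).

Definition cell_vector (w : Om) : {ffun K * bool -> 'I_L.+2} :=
  [ffun j => trunc L (cell_count j w)].

Definition cell_pmf (j : K * bool) (v : 'I_L.+2) : R := trunc_pmf (cell_law j) v.

Lemma discrete_cell_vector : discrete_rv cell_vector.
Proof.
apply: discrete_rv_ffun => j.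
exact: (discrete_rv_comp (trunc L) (discrete_cell_count j)).
Qed.

Lemma cell_vector_law x :
  prob P (cell_vector @^-1` [set x]) = weight cell_pmf x.
Proof.
apply: prob_eq.
have -> : cell_vector @^-1` [set x] =
    [set w | forall j, (trunc L @^-1` [set x j]) (cell_count j w)].
  apply/seteqP; split=> w /=.
    by move=> /ffunP h j; have := h j; rewrite ffunE.
  by move=> h; apply/ffunP => j; rewrite ffunE; exact: h.
rewrite (cell_counts_product (fun j => trunc L @^-1` [set x j])).
rewrite /weight -prodEFin; apply: eq_bigr => j _.
by rewrite probE.
Qed.

Lemma integral_cell_vector (phi : {ffun K * bool -> 'I_L.+2} -> R) :
  (forall x, 0 <= phi x) ->
  (\int[P]_w (phi (cell_vector w))%:E)%E = (expect cell_pmf phi)%:E.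
Proof.
move=> phi0; rewrite integral_finite //; last exact: discrete_cell_vector.
by congr (_%:E); apply: eq_bigr => x _; rewrite cell_vector_law.
Qed.

(** The number of letters of the first expedition in the class [T]; below,
    [count_in'] is the same for the second one. *)
Definition count_in (T : {pred K}) (w : Om) : nat :=
  (\sum_(0 <= i < n w) (Y i w \in T))%N.
Definition count_in' (T : {pred K}) (w : Om) : nat :=
  (\sum_(n w <= i < n w + m w) (Y i w \in T))%N.

Lemma sum_cell_count (T : {pred K}) (r : seq nat) w :
  (\sum_(a in T) \sum_(i <- r) (Y i w == a) = \sum_(i <- r) (Y i w \in T))%N.
Proof.
rewrite exchange_big /=; apply: eq_bigr => i _.
have [YT|YT] := boolP (Y i w \in T).
  rewrite (bigD1 (Y i w)) //= eqxx big1 // => a /andP[_ /negbTE].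
  by rewrite eq_sym => ->.
by rewrite big1 // => a aT; case: eqP => // e; rewrite e aT in YT.
Qed.

Lemma count_inE T w : count_in T w = (\sum_(a in T) cell_count (a, false) w)%N.
Proof.
rewrite /count_in -sum_cell_count; apply: eq_bigr => a _.
by rewrite /cell_count /= ffunE.
Qed.

Lemma count_in'E T w : count_in' T w = (\sum_(a in T) cell_count (a, true) w)%N.
Proof.
rewrite /count_in' -sum_cell_count; apply: eq_bigr => a _.
by rewrite /cell_count /= ffunE.
Qed.

End one_alphabet.

(** A class of letters is a letter of the alphabet [bool]. *)
Lemma poissonized_class (K : finType) (Y : nat -> Om -> K) q n m t t'
    (T : {pred K}) : poissonized Y q n m t t' ->
  poissonized (fun i w => Y i w \in T)
    (fun b : bool => \sum_(a | (a \in T) == b) q a) n m t t'.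
Proof.
move=> [mY lY mn mm rule].
have mT i : discrete_rv (fun w => Y i w \in T).
  exact: (discrete_rv_comp (fun a => a \in T) (mY i)).
split=> // [i b|n0 m0 k C].
  rewrite (total_measure P (mY i)); last exact: mT.
  rewrite (bigID [pred a | (a \in T) == b]) /= [X in (_ + X)%E]big1 ?adde0.
    rewrite -sumEFin; apply: eq_bigr => a /eqP aT; rewrite -(lY i).
    by congr (P _); apply/seteqP; split=> [w []//|w /= ->].
  move=> a /eqP aT; rewrite -(measure0 P); congr (P _).
  by apply/seteqP; split=> // w [/= h e]; apply: aT; rewrite -e.
exact: (rule n0 m0 k (fun i => [set a | C i (a \in T)])).
Qed.

End poissonized.

(** * Error of one species *)

Section scores.
Context (R : realType).
Implicit Types (H G : nat -> R).

Definition cutoff (L : nat) H (i : nat) : R := if (i <= L)%N then H i else 0.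

(** The contribution of a species to [new_species - linear_estimator]. *)
Definition score H (N N' : nat) : R := ((N == 0%N) && (0 < N')%N)%:R - H N.

Lemma score_sqr H N N' : H 0%N = 0 ->
  score H N N' ^+ 2 = ((N == 0%N) && (0 < N')%N)%:R + H N ^+ 2.
Proof.
move=> H0; rewrite /score; case: eqP => [->|_] /=.
  by rewrite H0 subr0 expr0n addr0; case: (0 < N')%N; rewrite ?expr1n ?expr0n.
by rewrite sub0r sqrrN add0r.
Qed.

Lemma cutoff0 L H : H 0%N = 0 -> cutoff L H 0 = 0.
Proof. by []. Qed.

(** Mean of [(N == 0) && (0 < N') + G N] for Poisson counts of rates [t p] and
    [t' p], when [G] vanishes above [L]. *)
Definition poisson_mean (t t' p : R) (L : nat) G : R :=
  pois (t * p) 0 * (1 - pois (t' * p) 0) + \sum_(i < L.+1) pois (t * p) i * G i.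

End scores.

Section class_statistics.
Context d (Om : measurableType d) (R : realType) (P : probability Om R).
Context (K : finType) (Y : nat -> Om -> K) (q : K -> R).
Context (n m : Om -> nat) (t t' : R).
Hypothesis sampling : poissonized P Y q n m t t'.
Context (L : nat).

Local Notation state := {ffun K * bool -> 'I_L.+2}.

Definition class_counts (T : {pred K}) (x : state) : nat * nat :=
  ((\sum_(a in T) x (a, false))%N, (\sum_(a in T) x (a, true))%N).

(** What a cut off score depends on. *)
Definition observed (u : nat * nat) : 'I_L.+2 * bool := (trunc L u.1, (0 < u.2)%N).

Lemma trunc_sum (T : {pred K}) (f : K -> nat) :
  trunc L (\sum_(a in T) trunc L (f a))%N = trunc L (\sum_(a in T) f a)%N.
Proof.
apply/val_inj => /=; rewrite !truncE; under eq_bigr do rewrite truncE.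
elim/big_rec2 : _ => // a x y _.
by move=> IH; lia.
Qed.

(** Truncating the cells before adding them up does not change the truncated
    class counts, so the score of a class is a function of the finite vector. *)
Lemma observed_cell_vector T w :
  observed (class_counts T (cell_vector Y n m L w)) =
  observed (count_in Y n T w, count_in' Y n m T w).
Proof.
rewrite /observed /class_counts /=; congr pair.
  by under eq_bigr do rewrite ffunE; rewrite trunc_sum -count_inE.
rewrite count_in'E !lt0n !sum_nat_eq0; congr (~~ _); apply: eq_forallb => a.
by rewrite ffunE truncE; case: (cell_count _ _ _ _ _) => [|k];
  rewrite ?min0n // minnSS.
Qed.

Lemma score_observed (H : nat -> R) N N' :
  score (cutoff L H) N N' =
  ((((observed (N, N')).1 : nat) == 0%N) && (observed (N, N')).2)%:R
  - cutoff L H (observed (N, N')).1.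
Proof.
rewrite /score /observed /= truncE; congr (_%:R - _).
  by congr (_ && _); case: N => [|k]; rewrite ?min0n // minnSS.
rewrite /cutoff /minn; case: ltnP => //; rewrite ltnn => NL.
by rewrite leqNgt NL.
Qed.

Definition class_score (H : nat -> R) (T : {pred K}) (x : state) : R :=
  score (cutoff L H) (class_counts T x).1 (class_counts T x).2.

Lemma class_score_cell_vector (H : nat -> R) T w :
  class_score H T (cell_vector Y n m L w) =
  score (cutoff L H) (count_in Y n T w) (count_in' Y n m T w).
Proof.
rewrite /class_score [RHS]score_observed -observed_cell_vector.
by rewrite score_observed -surjective_pairing.
Qed.

Hypotheses (t0 : 0 <= t) (t'0 : 0 <= t').

Definition class_prob (T : {pred K}) : R := \sum_(a in T) q a.

(** Merging the letters into the class and its complement makes the class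
    counts cell counts, whose laws are known. *)
Lemma observed_law T (v : 'I_L.+2) (b : bool) :
  prob P ((fun w => observed (count_in Y n T w, count_in' Y n m T w))
            @^-1` [set (v, b)]) =
  trunc_pmf (poisson_prob (t * class_prob T) 0) v *
  (if b then 1 - pois (t' * class_prob T) 0 else pois (t' * class_prob T) 0).
Proof.
have sT := poissonized_class T sampling.
set q' := (fun b : bool => _) in sT.
have q'E : q' true = class_prob T by apply: eq_bigl => a; rewrite eqb_id.
have p0 : 0 <= class_prob T by apply: sumr_ge0 => a _; exact: letter_ge0 sampling a.
pose E (j : bool * bool) : set nat :=
  if j.1 then if j.2 then [set k | (0 < k)%N = b] else trunc L @^-1` [set v]
  else setT.
apply: prob_eq.
transitivity (P [set w | forall j,
    E j (cell_count (fun i w => Y i w \in T) n m j w)]).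
  congr (P _); apply/seteqP; split=> w /=.
    rewrite /observed => -[/= e1 e2] [[] []]; rewrite /E //=.
      by rewrite /cell_count /= ffunE -e2; under eq_bigr do rewrite eqb_id.
    by rewrite /cell_count /= ffunE -e1; under eq_bigr do rewrite eqb_id.
  move=> h; congr pair.
    have := h (true, false); rewrite /E /cell_count /= ffunE => <-.
    by rewrite /observed /=; under [in RHS]eq_bigr do rewrite eqb_id.
  have := h (true, true); rewrite /E /cell_count /= ffunE => <-.
  by under [in RHS]eq_bigr do rewrite eqb_id.
rewrite (cell_counts_product sT t0 t'0).
rewrite (bigD1 (true, false)) //= (bigD1 (true, true)) //= big1 ?mule1; last first.
  by move=> [[] []] //= _; rewrite /E /= probability_setT.
rewrite /E /= /cell_law /= q'E EFinM; congr (_ * _)%E; first exact: probE.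
have pe : poisson_prob (t' * class_prob T) 0 [set 0%N] =
    (pois (t' * class_prob T) 0)%:E.
  by apply: poisson_prob_set1; rewrite mulr_ge0.
case: b {E}.
  have -> : [set k | (0 < k)%N = true] = ~` [set 0%N].
    by apply/seteqP; split=> -[|k] //=.
  by rewrite probability_setC // EFinB -pe.
rewrite -pe; congr (_ _); apply/seteqP; split=> -[|k] //=.
Qed.

Lemma expect_observed T (phi : 'I_L.+2 * bool -> R) :
  expect (cell_pmf q t t' (L := L)) (fun x => phi (observed (class_counts T x))) =
  \sum_v \sum_(b : bool) trunc_pmf (poisson_prob (t * class_prob T) 0) v *
  (if b then 1 - pois (t' * class_prob T) 0 else pois (t' * class_prob T) 0) *
  phi (v, b).
Proof.
rewrite /expect.
under eq_bigr do rewrite -(cell_vector_law sampling t0 t'0).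
rewrite (sum_law_comp P (fun x => observed (class_counts T x)) phi
  (@discrete_cell_vector _ _ _ _ _ _ _ _ _ _ _ sampling L)).
rewrite pair_big /=; apply: eq_bigr => -[v b] _ /=.
rewrite -observed_law; congr (prob P _ * _).
apply/seteqP; split=> w /=.
  by rewrite -observed_cell_vector.
by rewrite -observed_cell_vector.
Qed.

Lemma expect_class T (G : nat -> R) : (forall i, (L < i)%N -> G i = 0) ->
  expect (cell_pmf q t t' (L := L)) (fun x =>
    (((observed (class_counts T x)).1 == 0%N :> nat)
       && (observed (class_counts T x)).2)%:R + G (observed (class_counts T x)).1) =
  poisson_mean t t' (class_prob T) L G.
Proof.
move=> G0.
rewrite (expect_observed T (fun u => ((u.1 == 0%N :> nat) && u.2)%:R + G u.1)).
set nu := poisson_prob _ _; set p := class_prob T.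
have p0 : 0 <= p by apply: sumr_ge0 => a _; exact: letter_ge0 sampling a.
transitivity (\sum_(v < L.+2) (trunc_pmf nu v * (v == 0%N :> nat)%:R *
    (1 - pois (t' * p) 0) + trunc_pmf nu v * G v)).
  apply: eq_bigr => v _; rewrite big_bool /= andbT andbF add0r; ring.
have small (v : 'I_L.+2) : (v <= L)%N -> trunc_pmf nu v = pois (t * p) v.
  move=> vL; rewrite trunc_pmf_small //; apply: prob_eq.
  by apply: poisson_prob_set1; rewrite mulr_ge0.
rewrite big_split /=; congr (_ + _).
  rewrite (bigD1 ord0) //= big1 ?addr0 ?small ?mulr1 // => v v0.
  by rewrite (_ : (_ == _) = false) ?mulr0 ?mul0r //; apply/negbTE.
rewrite big_ord_recr /= G0 // mulr0 addr0.
by apply: eq_bigr => v _; rewrite small //= -ltnS.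
Qed.

Context (H : nat -> R) (H0 : H 0%N = 0).

Lemma expect_class_score T :
  expect (cell_pmf q t t' (L := L)) (class_score H T) =
  poisson_mean t t' (class_prob T) L (fun i => - H i).
Proof.
rewrite /class_score.
transitivity (poisson_mean t t' (class_prob T) L (fun i => - cutoff L H i)).
  rewrite -expect_class; last by move=> i; rewrite /cutoff ltnNge => /negbTE ->; rewrite oppr0.
  apply: eq_bigr => x _; congr (_ * _).
  by rewrite score_observed -surjective_pairing.
congr (_ + _); apply: eq_bigr => i _.
by rewrite /cutoff -ltnS ltn_ord.
Qed.

Lemma expect_class_score_sqr T :
  expect (cell_pmf q t t' (L := L)) (fun x => class_score H T x ^+ 2) =
  poisson_mean t t' (class_prob T) L (fun i => H i ^+ 2).
Proof.
rewrite /class_score.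
transitivity (poisson_mean t t' (class_prob T) L (fun i => cutoff L H i ^+ 2)).
  rewrite -expect_class; last first.
    by move=> i; rewrite /cutoff ltnNge => /negbTE ->; rewrite expr0n.
  apply: eq_bigr => x _; congr (_ * _).
  rewrite score_observed -surjective_pairing.
  set v := (observed _).1; set b := (observed _).2.
  have [v0|v0] := eqVneq (v : nat) 0%N; last by rewrite /= sub0r sqrrN add0r.
  rewrite v0 cutoff0 // subr0 expr0n addr0 /=.
  by case: b; rewrite ?expr1n ?expr0n.
congr (_ + _); apply: eq_bigr => i _.
by rewrite /cutoff -ltnS ltn_ord.
Qed.

End class_statistics.

(** * Second moments of truncated errors *)

Section score_sums.
Context d (Om : measurableType d) (R : realType) (P : probability Om R).
Context (K : finType) (Y : nat -> Om -> K) (q : K -> R).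
Context (n m : Om -> nat) (t t' : R).
Hypothesis sampling : poissonized P Y q n m t t'.
Hypotheses (t0 : 0 <= t) (t'0 : 0 <= t').
Context (L : nat) (H : nat -> R) (H0 : H 0%N = 0).
Context (I : finType) (T : I -> {pred K}).

Local Notation state := {ffun K * bool -> 'I_L.+2}.
Local Notation Ex := (expect (cell_pmf q t t' (L := L))).

Definition score_sum w : R :=
  \sum_i score (cutoff L H) (count_in Y n (T i) w) (count_in' Y n m (T i) w).

Lemma integral_score_sum_sqr :
  (\int[P]_w (score_sum w ^+ 2)%:E)%E =
  (Ex (fun x => (\sum_i class_score H (T i) x) ^+ 2))%:E.
Proof.
rewrite -(integral_cell_vector sampling t0 t'0); last by move=> x; exact: sqr_ge0.
apply: eq_integral => w _; congr (_ ^+ 2)%:E; apply: eq_bigr => i _.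
by rewrite class_score_cell_vector.
Qed.

Lemma measurable_score_sum_sqr :
  measurable_fun setT (fun w => (score_sum w ^+ 2)%:E).
Proof.
apply: discrete_rv_measurable.
rewrite (_ : (fun w => _) =
    fun w => ((\sum_i class_score H (T i) (cell_vector Y n m L w)) ^+ 2)%:E).
  apply: (discrete_rv_comp (fun x : state =>
    ((\sum_i class_score H (T i) x) ^+ 2)%:E)).
  exact: (@discrete_cell_vector _ _ _ _ _ _ _ _ _ _ _ sampling L).
apply/funext => w; congr (_ ^+ 2)%:E; apply: eq_bigr => i _.
by rewrite class_score_cell_vector.
Qed.

Lemma class_score_free (C : {pred K}) (j : K * bool) :
  j.1 \notin C -> free_of j (class_score (L := L) H C).
Proof.
move=> jC x v; rewrite /class_score /class_counts /=.
congr score; apply: eq_bigr => a aC; rewrite ffunE; case: eqP => // e;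
  by rewrite -e /= aC in jC.
Qed.

(** A letter of probability zero has count zero. *)
Lemma cell_pmf_null a b (v : 'I_L.+2) :
  q a = 0 -> v != ord0 -> cell_pmf q t t' (a, b) v = 0.
Proof.
move=> qa v0; rewrite /cell_pmf; set nu := cell_law _ _ _ _.
have := trunc_pmf_sum1 L nu; rewrite (bigD1 ord0) //=.
have -> : trunc_pmf nu (ord0 : 'I_L.+2) = 1.
  rewrite trunc_pmf_small //; apply: prob_eq.
  rewrite (cell_law_set1 sampling t0 t'0) /= qa mulr0 /pois oppr0 expR0 expr0.
  by rewrite fact0 divr1 mulr1.
move=> /eqP; rewrite -subr_eq0 addrAC subrr add0r psumr_eq0 => [|u _].
  by move=> /allP /(_ v (mem_index_enum v)); rewrite v0 => /eqP.
exact: trunc_pmf_ge0.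
Qed.

Lemma weight_null (x : state) a b :
  q a = 0 -> x (a, b) != ord0 -> weight (cell_pmf q t t' (L := L)) x = 0.
Proof.
by move=> qa xa; rewrite /weight (bigD1 (a, b)) //= cell_pmf_null // mul0r.
Qed.

Definition support (C : {pred K}) : {pred K} := [pred a | (a \in C) && (q a != 0)].

Lemma class_prob_support C : class_prob q (support C) = class_prob q C.
Proof.
rewrite /class_prob [RHS](bigID [pred a | q a == 0]) /=.
rewrite [X in _ = X + _]big1 ?add0r => [|a /andP[_ /eqP //]].
by apply: eq_bigl.
Qed.

Lemma class_score_support (x : state) C :
  weight (cell_pmf q t t' (L := L)) x != 0 ->
  class_score H (support C) x = class_score H C x.
Proof.
move=> wx; rewrite /class_score /class_counts /=.
have e b : (\sum_(a in support C) x (a, b) = \sum_(a in C) x (a, b))%N.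
  rewrite [RHS](bigID [pred a | q a == 0]) /=.
  rewrite [X in (_ = X + _)%N]big1 ?add0n => [|a /andP[_ /eqP qa]].
    by apply: eq_bigl.
  by apply/eqP; apply: contraNT wx => xa; apply/eqP; apply: (weight_null qa (b := b)).
by rewrite !e.
Qed.

(** Letters of probability zero may belong to too many classes; removing them
    from the classes changes the scores on a null set only. *)
Lemma integral_score_sum_le (B : nat) :
    (forall a, q a != 0 -> (#|[pred i | a \in T i]| <= B)%N) ->
  (\int[P]_w (score_sum w ^+ 2)%:E <=
   ((\sum_i poisson_mean t t' (class_prob q (T i)) L (fun k => - H k)%R) ^+ 2
    + B%:R * \sum_i poisson_mean t t' (class_prob q (T i)) L (fun k => H k ^+ 2)%R
   )%:E)%E.
Proof.
move=> TB; rewrite integral_score_sum_sqr lee_fin.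
have -> : Ex (fun x => (\sum_i class_score H (T i) x) ^+ 2) =
    Ex (fun x => (\sum_i class_score H (support (T i)) x) ^+ 2).
  apply: eq_bigr => x _.
  have [->|wx] := eqVneq (weight (cell_pmf q t t' (L := L)) x) 0.
    by rewrite !mul0r.
  by congr (_ * _ ^+ 2); apply: eq_bigr => i _; rewrite class_score_support.
under eq_bigr do rewrite -class_prob_support -(expect_class_score sampling L t0 t'0 H).
under [X in _ <= _ + _ * X]eq_bigr do
  rewrite -class_prob_support -(expect_class_score_sqr sampling L t0 t'0 H0).
apply: (second_moment_sum_le _ _ (T := fun i => [pred j | j.1 \in support (T i)])).
- by move=> j v; exact: trunc_pmf_ge0.
- by move=> j; exact: trunc_pmf_sum1.
- move=> [a b]; have [qa|qa] := eqVneq (q a) 0.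
    by rewrite (@eq_card0 _ _) // => i; rewrite !inE /= qa eqxx andbF.
  apply: leq_trans (TB a qa); apply: subset_leq_card; apply/fintype.subsetP => i.
  by rewrite !inE /= => /andP[].
- by move=> i j jT; exact: class_score_free.
Qed.

(** Scores of disjoint classes depend on disjoint sets of cells, so their mixed
    moments factor. *)
Lemma integral_score_sum_disjoint :
    (forall i j a, i != j -> a \in T i -> a \notin T j) ->
  let e1 i := poisson_mean t t' (class_prob q (T i)) L (fun k => - H k) in
  let e2 i := poisson_mean t t' (class_prob q (T i)) L (fun k => H k ^+ 2) in
  (\int[P]_w (score_sum w ^+ 2)%:E =
   ((\sum_i e1 i) ^+ 2 + \sum_i (e2 i - e1 i ^+ 2))%R%:E)%E.
Proof.
move=> Tdisj e1 e2; rewrite integral_score_sum_sqr; congr (_%:E).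
have s1 j : \sum_v cell_pmf q t t' (L := L) j v = 1 by exact: trunc_pmf_sum1.
transitivity (\sum_i \sum_j
    Ex (fun x => class_score H (T i) x * class_score H (T j) x)).
  transitivity (Ex (fun x => \sum_i \sum_j
      class_score H (T i) x * class_score H (T j) x)).
    apply: eq_bigr => x _; congr (_ * _); rewrite expr2 mulr_suml.
    by apply: eq_bigr => i _; rewrite mulr_sumr.
  by rewrite expect_sum; apply: eq_bigr => i _; rewrite expect_sum.
have off i j : i != j ->
    Ex (fun x => class_score H (T i) x * class_score H (T j) x) = e1 i * e1 j.
  move=> ij; rewrite expectM_free //; last first.
    move=> a; have [aT|aT] := boolP (a.1 \in T i).
      by right; apply: class_score_free; exact: Tdisj aT.
    by left; exact: class_score_free.
  by rewrite !(expect_class_score sampling L t0 t'0 H).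
have diag i : Ex (fun x => class_score H (T i) x * class_score H (T i) x) = e2 i.
  by rewrite /e2 -(expect_class_score_sqr sampling L t0 t'0 H0).
transitivity (\sum_i (\sum_j e1 i * e1 j + (e2 i - e1 i ^+ 2))).
  apply: eq_bigr => i _; rewrite (bigD1 i) //= [in RHS](bigD1 i) //= diag.
  rewrite (eq_bigr (fun j => e1 i * e1 j)) => [|j ji]; last first.
    by rewrite off // eq_sym.
  ring.
rewrite big_split /=; congr (_ + _); rewrite expr2 mulr_suml.
by apply: eq_bigr => i _; rewrite mulr_sumr.
Qed.

End score_sums.

(** * Series estimates for bias and second moment *)

Lemma cvg_fin_sum (R : realType) (I : finType) (f : I -> nat -> R) (l : I -> R) :
  (forall i, f i @ \oo --> l i) ->
  (fun n => \sum_i f i n) @ \oo --> \sum_i l i.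
Proof.
move=> fl; elim: (index_enum I) => [|i s IH].
  by under eq_fun do rewrite big_nil; rewrite big_nil; exact: cvg_cst.
by under eq_fun do rewrite big_cons; rewrite big_cons; exact: cvgD.
Qed.

Lemma limn_einf_le_cvg (R : realType) (u v : nat -> \bar R) l :
  (forall n, (u n <= v n)%E) -> v @ \oo --> l -> (limn_einf u <= l)%E.
Proof.
move=> uv vl; rewrite limn_einf_lim -(cvg_lim _ vl) //; apply: lee_lim.
- by apply: ereal_nondecreasing_is_cvgn; exact: nondecreasing_einfs.
- exact: cvgP vl.
- apply: nearW => n; apply: le_trans (uv n).
  by apply: ereal_inf_lbound; exists n => //=.
Qed.

Section series_bounds.
Context (R : realType).
Implicit Types (a c : nat -> R).

(** The partial sums that [gen_fun] is the limit of; they start at [1]. *)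
Definition partial c (n : nat) : R := \sum_(1 <= i < n) c i.

Lemma partialS c n : (0 < n)%N -> partial c n.+1 = partial c n + c n.
Proof. by move=> n0; rewrite /partial big_nat_recr. Qed.

Lemma partial_le a m n : (forall i, 0 <= a i) -> (m <= n)%N ->
  partial a m <= partial a n.
Proof.
move=> a0; elim: n => [|n IH]; first by rewrite leqn0 => /eqP ->.
rewrite leq_eqVlt ltnS => /orP[/eqP -> //|/IH /le_trans]; apply.
case: n {IH} => [|n]; first by rewrite /partial !big_geq.
by rewrite [leRHS]partialS // lerDl.
Qed.

Lemma partial_cvg a C : (forall i, 0 <= a i) -> (forall n, partial a n <= C) ->
  cvgn (partial a).
Proof.
move=> a0 aC; apply: nondecreasing_is_cvgn.
  by move=> m n; exact: partial_le.
by exists C => _ [n _ <-].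
Qed.

Lemma partial_le_lim a C n : (forall i, 0 <= a i) ->
  (forall n, partial a n <= C) -> partial a n <= limn (partial a).
Proof.
move=> a0 aC; apply: nondecreasing_cvgn_le; last exact: partial_cvg a0 aC.
by move=> i j; exact: partial_le.
Qed.

(** [c] is the difference of [c + a] and [a], which are both nonnegative. *)
Lemma partial_dominated_cvg a c C : (forall i, `|c i| <= a i) ->
  (forall n, partial a n <= C) -> cvgn (partial c).
Proof.
move=> ca aC; have a0 i : 0 <= a i by exact: le_trans (ca i).
have -> : partial c = partial (fun i => c i + a i) \- partial a.
  apply/funext => n /=; rewrite /partial big_split /=.
  by rewrite addrK.
apply: is_cvgB; last exact: partial_cvg a0 aC.
apply: (@partial_cvg _ (C + C)) => [i|n].
  by rewrite -lerBlDr sub0r; have := ca i; rewrite ler_norml => /andP[].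
rewrite /partial big_split /=; apply: lerD; last exact: aC.
apply: le_trans (aC n); apply: ler_sum => i _.
by apply: le_trans (ca i); exact: ler_norm.
Qed.

Lemma partial_tail a c C k n : (forall i, `|c i| <= a i) ->
    (forall n, partial a n <= C) ->
    (forall i, (n <= i)%N -> `|c i| <= k * a i) -> 0 <= k -> (0 < n)%N ->
  `|limn (partial c) - partial c n| <= k * (limn (partial a) - partial a n).
Proof.
move=> ca aC cka k0 n0; have a0 i : 0 <= a i by exact: le_trans (ca i).
have cc := partial_dominated_cvg ca aC.
have h N : (n <= N)%N ->
    `|partial c N - partial c n| <= k * (limn (partial a) - partial a n).
  move=> nN; rewrite /partial (big_cat_nat n0 nN) /= addrAC subrr add0r.
  apply: (@le_trans _ _ (k * (partial a N - partial a n))).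
    rewrite /partial [in leRHS](big_cat_nat n0 nN) /= addrAC subrr add0r mulr_sumr.
    apply: (le_trans (ler_norm_sum _ _ _)).
    rewrite big_nat_cond [leRHS]big_nat_cond.
    by apply: ler_sum => i /andP[/andP[ni _] _]; exact: cka.
  by rewrite ler_wpM2l // lerD2r; exact: partial_le_lim a0 aC.
have cvg : (fun N => `|partial c N - partial c n|) @ \oo -->
    `|limn (partial c) - partial c n|.
  by apply: cvg_norm; apply: cvgB => //; exact: cvg_cst.
rewrite -(cvg_lim (@Rhausdorff R) cvg); apply: limr_le; first exact: cvgP cvg.
by near=> N; apply: h; near: N; exact: nbhs_infty_ge.
Unshelve. all: by end_near. Qed.

End series_bounds.

Section coefficient_series.
Context (R : realType) (r t : R) (H : nat -> R).
Hypotheses (r0 : 0 < r) (t0 : 0 < t) (H0 : H 0%N = 0).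

Definition coef (G : nat -> R) (x : R) (i : nat) : R := G i / i`!%:R * x ^+ i.

(** The condition under which [G_fun] is not infinite by definition. *)
Definition energy_finite : Prop :=
  (\sum_(1 <= i <oo) (H i ^+ 2 * t ^+ i / i`!%:R)%:E != +oo)%E.

Lemma coef_ge0 G x i : (forall j, 0 <= G j) -> 0 <= x -> 0 <= coef G x i.
Proof. by move=> G0 x0; rewrite /coef mulr_ge0 ?exprn_ge0 // divr_ge0. Qed.

Lemma partial_exp_le n : partial (coef (fun=> 1) t) n <= expR t.
Proof.
have -> : coef (fun=> 1) t = exp_coeff t.
  by apply/funext => i; rewrite /coef exp_coeffE mul1r.
apply: le_trans (_ : series (exp_coeff t) n <= _).
  rewrite /series /= /partial; case: n => [|n]; first by rewrite !big_geq.
  by rewrite [leRHS]big_ltn // lerDr exp_coeff_ge0 // ltW.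
rewrite /expR; apply: nondecreasing_cvgn_le; last exact: is_cvg_series_exp_coeff.
by apply/nondecreasing_seqP => k; rewrite /series /= big_nat_recr //= lerDl
  exp_coeff_ge0 // ltW.
Qed.

Lemma poisson_meanE G p L : G 0%N = 0 ->
  poisson_mean t (r * t) p L G =
  expR (- (p * t)) * (1 - expR (- (r * p * t)) + partial (coef G (p * t)) L.+1).
Proof.
move=> G0; rewrite /poisson_mean [in RHS]mulrDr; congr (_ + _).
  rewrite /pois expr0 expr0 fact0 divr1 !mulr1 [t * p]mulrC.
  by congr (_ * (1 - expR (- _))); rewrite mulrAC.
rewrite /partial -(big_mkord xpredT (fun i => pois (t * p) i * G i)).
rewrite big_ltn // G0 mulr0 add0r mulr_sumr; apply: eq_bigr => i _.
rewrite /pois /coef [t * p]mulrC; ring.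
Qed.

Lemma partial_coefN G x n : partial (coef (fun i => - G i) x) n = - partial (coef G x) n.
Proof.
by rewrite /partial -sumrN; apply: eq_bigr => i _; rewrite /coef !mulNr.
Qed.

Lemma energy_finite_bounded C :
  (forall n, partial (coef (fun i => H i ^+ 2) t) n <= C) -> energy_finite.
Proof.
move=> hC; rewrite /energy_finite.
have S0 n : (0 <= (H n ^+ 2 * t ^+ n / n`!%:R)%:E)%E.
  by rewrite lee_fin divr_ge0 // mulr_ge0 ?sqr_ge0 // exprn_ge0 // ltW.
have : (\sum_(1 <= i <oo) (H i ^+ 2 * t ^+ i / i`!%:R)%:E <= C%:E)%E.
  apply: lime_le; first exact: is_cvg_nneseries.
  apply: nearW => n; rewrite sumEFin lee_fin; apply: le_trans (hC n).
  by apply: ler_sum => i _; rewrite /coef mulrAC.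
by case: eqP => // ->; rewrite leye_eq.
Qed.

Context (fin : energy_finite).

Lemma energy_bound : exists C, forall n, partial (coef (fun i => H i ^+ 2) t) n <= C.
Proof.
pose S := (\sum_(1 <= i <oo) (H i ^+ 2 * t ^+ i / i`!%:R)%:E)%E.
have Sy : S != +oo%E by exact: fin.
have S0 n : (0 <= (H n ^+ 2 * t ^+ n / n`!%:R)%:E)%E.
  by rewrite lee_fin divr_ge0 // mulr_ge0 ?sqr_ge0 // exprn_ge0 // ltW.
have Sfin : S \is a fin_num.
  by rewrite ge0_fin_numE ?lt_neqAle ?Sy ?leey //; exact: nneseries_ge0.
exists (fine S) => n; rewrite -lee_fin fineK // /partial -sumEFin.
apply: le_trans (nneseries_lim_ge (m := 1) (P := xpredT) n _); last by [].
apply: lee_sum => i _; rewrite lee_fin /coef; lra.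
Qed.

Definition abs_coef := coef (fun i => `|H i|) t.

(** [|H i| <= 1 + H i ^ 2] bounds this series by the exponential one and the
    energy. *)
Lemma abs_bound : exists C, forall n, partial abs_coef n <= C.
Proof.
have [C hC] := energy_bound; exists (expR t + C) => n.
apply: le_trans (lerD (partial_exp_le n) (hC n)).
rewrite /partial -big_split /=; apply: ler_sum => i _.
rewrite /abs_coef /coef -mulrDl -mulrDl ler_wpM2r ?exprn_ge0 ?(ltW t0) //.
rewrite ler_wpM2r ?invr_ge0 //.
have := sqr_ge0 (`|H i| - 1); rewrite -(real_normK (num_real (H i))); nra.
Qed.

Section fixed_probability.
Context (p : R) (p01 : 0 <= p <= 1).

Lemma coef_abs_le n i : (n <= i)%N -> `|coef H (p * t) i| <= p ^+ n * abs_coef i.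
Proof.
move=> ni; have /andP[p0 p1] := p01.
rewrite /abs_coef /coef !normrM normfV normr_nat normrX normrM.
rewrite (ger0_norm p0) (ger0_norm (ltW t0)) exprMn mulrCA ler_wpM2r //.
  by rewrite mulr_ge0 ?exprn_ge0 ?(ltW t0) // divr_ge0.
exact: ler_wiXn2l.
Qed.


Definition abs_total := limn (partial abs_coef).

Lemma abs_coef_le i : `|coef H (p * t) i| <= abs_coef i.
Proof. by have := coef_abs_le (leq0n i); rewrite expr0 mul1r. Qed.

Lemma gen_fun_cvg :
  partial (coef H (p * t)) @ \oo --> gen_fun H (p * t).
Proof.
have [C hC] := abs_bound.
exact: (partial_dominated_cvg abs_coef_le hC).
Qed.

(** The powers of [p] that are gained here make the tail of [gen_fun] negligible
    against [p] uniformly in [p], and its terms of order two against [p] as [p]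
    tends to zero. *)
Lemma gen_fun_tail n : (0 < n)%N ->
  `|gen_fun H (p * t) - partial (coef H (p * t)) n| <=
  p ^+ n * (abs_total - partial abs_coef n).
Proof.
move=> n0; have [C hC] := abs_bound.
apply: partial_tail hC _ _ n0 => [i|i|].
- exact: abs_coef_le.
- exact: coef_abs_le.
- by rewrite exprn_ge0 //; case/andP: p01.
Qed.

Lemma sqr_coef_le i :
  coef (fun i => H i ^+ 2) (p * t) i <= coef (fun i => H i ^+ 2) t i.
Proof.
have /andP[p0 p1] := p01; rewrite /coef ler_wpM2l ?divr_ge0 ?sqr_ge0 //.
by rewrite lerXn2r ?nnegrE ?mulr_ge0 ?(ltW t0) // ler_piMl // ltW.
Qed.

Lemma sqr_coef_ge0 i : 0 <= coef (fun i => H i ^+ 2) (p * t) i.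
Proof.
have /andP[p0 p1] := p01.
by rewrite coef_ge0 ?mulr_ge0 ?(ltW t0) // => j; exact: sqr_ge0.
Qed.

Lemma gen_sqr_cvg : partial (coef (fun i => H i ^+ 2) (p * t)) @ \oo -->
  gen_fun (fun i => H i ^+ 2) (p * t).
Proof.
have [C hC] := energy_bound; apply: (partial_cvg (C := C) sqr_coef_ge0) => n.
by apply: le_trans (hC n); apply: ler_sum => i _; exact: sqr_coef_le.
Qed.

Lemma gen_sqr_ge n : partial (coef (fun i => H i ^+ 2) (p * t)) n <=
  gen_fun (fun i => H i ^+ 2) (p * t).
Proof.
have [C hC] := energy_bound.
apply: (partial_le_lim (C := C) n sqr_coef_ge0) => k.
by apply: le_trans (hC k); apply: ler_sum => i _; exact: sqr_coef_le.
Qed.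

End fixed_probability.

Lemma abs_total_cvg : partial abs_coef @ \oo --> abs_total.
Proof.
have [C hC] := abs_bound; apply: (partial_cvg (C := C)) => // i.
by rewrite coef_ge0 // ltW.
Qed.

Lemma abs_total_ge n : partial abs_coef n <= abs_total.
Proof.
have [C hC] := abs_bound; apply: (partial_le_lim (C := C)) => // i.
by rewrite coef_ge0 // ltW.
Qed.

(** The mean error of a species of probability [p]; for [0 < p] its absolute
    value is [p] times [bias_at]. *)
Definition bias_mean p : R :=
  expR (- (p * t)) * (1 - expR (- (r * p * t)) - gen_fun H (p * t)).

(** The second moment of the error of a species of probability [p]; for
    [0 < p] it is [p] times [var_at]. *)
Definition second_mean p : R :=
  expR (- (p * t)) *
  (1 - expR (- (r * p * t)) + gen_fun (fun i => H i ^+ 2) (p * t)).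


Lemma exp_small (y : R) : 0 <= y -> y - y ^+ 2 <= 1 - expR (- y) <= y.
Proof.
move=> y0; have := expR_ge1Dx (- y); have := expR_ge1Dx y; rewrite expRN.
have := expR_gt0 y; set e := expR y => e0 h1 h2; apply/andP; split; last lra.
have : e^-1 <= (1 + y)^-1 by rewrite lef_pV2 // posrE; lra.
have : (1 + y)^-1 <= 1 - y + y ^+ 2.
  rewrite -div1r ler_pdivrMr; nra.
lra.
Qed.

Lemma mean_approx p L : 0 <= p <= 1 ->
  `|poisson_mean t (r * t) p L (fun i => - H i)| <=
  `|bias_mean p| + p * (abs_total - partial abs_coef L.+1).
Proof.
move=> p01; have /andP[p0 p1] := p01.
rewrite poisson_meanE ?H0 ?oppr0 // partial_coefN.
have := gen_fun_tail p01 (ltn0Sn L); set g := gen_fun _ _; set s := partial _ _.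
move=> gs; have d0 : 0 <= abs_total - partial abs_coef L.+1.
  by rewrite subr_ge0 abs_total_ge.
have pL : p ^+ L.+1 * (abs_total - partial abs_coef L.+1) <=
    p * (abs_total - partial abs_coef L.+1).
  by rewrite ler_wpM2r // exprS ler_piMr // exprn_ile1.
apply: le_trans (lerD (lexx _) (le_trans gs pL)).
rewrite /bias_mean -/g; set e := expR (- (p * t)); set u := 1 - _.
have e1 : e <= 1 by rewrite -expR0 ler_expR oppr_le0 mulr_ge0 // ltW.
have e0 : 0 <= e := expR_ge0 _.
have -> : e * (u - s) = e * (u - g) + e * (g - s) by ring.
apply: (le_trans (ler_normD _ _)); rewrite lerD2l normrM (ger0_norm e0).
by rewrite ler_piMl.
Qed.

Lemma mean_cvg p : 0 <= p <= 1 ->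
  (fun L => poisson_mean t (r * t) p L (fun i => - H i)) @ \oo --> bias_mean p.
Proof.
move=> p01; under eq_fun do rewrite poisson_meanE ?H0 ?oppr0 // partial_coefN.
apply: cvgMr; apply: cvgB; first exact: cvg_cst.
by have := gen_fun_cvg p01; rewrite -cvg_shiftS.
Qed.

Lemma second_le p L : 0 <= p <= 1 ->
  poisson_mean t (r * t) p L (fun i => H i ^+ 2) <= second_mean p.
Proof.
move=> p01; rewrite poisson_meanE ?H0 ?expr0n // ler_wpM2l ?expR_ge0 //.
by rewrite lerD2l gen_sqr_ge.
Qed.

Lemma second_cvg p : 0 <= p <= 1 ->
  (fun L => poisson_mean t (r * t) p L (fun i => H i ^+ 2)) @ \oo --> second_mean p.
Proof.
move=> p01; under eq_fun do rewrite poisson_meanE ?H0 ?expr0n //.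
apply: cvgMr; apply: cvgD; first exact: cvg_cst.
by have := gen_sqr_cvg p01; rewrite -cvg_shiftS.
Qed.

Lemma bias_atE p : 0 < p -> bias_at r t H p = `|bias_mean p| / p.
Proof.
move=> p0; rewrite /bias_at gt_eqF // /bias_mean normrM ger0_norm ?expR_ge0 //.
by rewrite mulrAC.
Qed.

Lemma var_atE p : 0 < p -> var_at r t H p = second_mean p / p.
Proof. by move=> p0; rewrite /var_at gt_eqF // mulrAC. Qed.

Lemma bias_factor_bound p : 0 <= p <= 1 ->
  `|1 - expR (- (r * p * t)) - gen_fun H (p * t)| <= p * (r * t + abs_total).
Proof.
move=> p01; have /andP[p0 p1] := p01.
have := gen_fun_tail p01 (ltn0Sn 0); rewrite expr1 [partial _ 1]big_geq // subr0.
rewrite [partial _ 1]big_geq // subr0 => g.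
have y0 : 0 <= r * p * t by rewrite !mulr_ge0 // ltW.
have /andP[_ ey] := exp_small y0.
have e1 : expR (- (r * p * t)) <= 1 by rewrite -expR0 ler_expR oppr_le0.
apply: (le_trans (ler_normB _ _)); rewrite mulrDr; apply: lerD => //.
by rewrite ger0_norm ?subr_ge0 // mulrA [p * r]mulrC.
Qed.

Lemma bias_mean_bounded p : 0 <= p <= 1 ->
  `|bias_mean p| <= p * (r * t + abs_total).
Proof.
move=> p01; have /andP[p0 p1] := p01.
apply: le_trans (bias_factor_bound p01).
rewrite /bias_mean normrM (ger0_norm (expR_ge0 _)) ler_piMl //.
by rewrite -expR0 ler_expR oppr_le0 mulr_ge0 // ltW.
Qed.

Lemma le_of_small (X C D delta : R) : 0 < delta ->
  (forall p, 0 < p <= delta -> X <= C + p * D) -> X <= C.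
Proof.
move=> d0 h; apply/ler_addgt0Pr => e e0.
pose p := Num.min delta (e / (1 + `|D|)).
have D1 : 0 < 1 + `|D| by rewrite ltr_pwDl.
have p0 : 0 < p by rewrite lt_min d0 divr_gt0.
have /h /le_trans : 0 < p <= delta by rewrite p0 ge_min lexx.
apply; rewrite lerD2l; apply: (@le_trans _ _ (p * (1 + `|D|))).
  by rewrite ler_wpM2l ?(ltW p0) // ler_wpDl // ler_norm.
by rewrite -ler_pdivlMr // ge_min lexx orbT.
Qed.

(** The value at zero is the derivative of the bias there. Up to an error of
    order [p ^ 2], [1 - expR (- (r * p * t)) - gen_fun H (p * t)] equals
    [p * t * (r - H 1)]. *)
Lemma bias_at_zero C : (forall p, 0 < p <= 1 -> `|bias_mean p| <= p * C) ->
  t * `|r - H 1%N| <= C.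
Proof.
move=> hC; have A0 : 0 <= abs_total - partial abs_coef 2.
  by rewrite subr_ge0 abs_total_ge.
set A := abs_total - _ in A0.
apply: (@le_of_small _ C (t * (r * t + abs_total) + (r * t) ^+ 2 + A) 1) => //.
move=> p /andP[p0 p1]; have p01 : 0 <= p <= 1 by rewrite ltW.
have := gen_fun_tail p01 (isT : (0 < 2)%N); rewrite -/A.
have -> : partial (coef H (p * t)) 2 = H 1%N * (p * t).
  by rewrite /partial big_nat1 /coef (_ : 1`! = 1%N) // divr1 expr1.
have y0 : 0 <= r * p * t by rewrite !mulr_ge0 // ltW.
have /andP[] := exp_small y0.
have := bias_factor_bound p01.
have := hC p; rewrite p0 p1 => /(_ isT).
rewrite /bias_mean normrM (ger0_norm (expR_ge0 _)).
have := expR_ge1Dx (- (p * t)).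
set g := gen_fun _ _; set e := expR (- (p * t)); set u := expR _.
set w := `|1 - u - g| => e1 wC wB u1 u2 gA.
have w0 : 0 <= w by exact: normr_ge0.
have w1 : w <= p * C + p * t * (p * (r * t + abs_total)).
  have : (1 - p * t) * w <= p * C by apply: le_trans wC; rewrite ler_wpM2r.
  have : p * t * w <= p * t * (p * (r * t + abs_total)).
    by rewrite ler_wpM2l // mulr_ge0 // ltW.
  lra.
have : p * (t * `|r - H 1%N|) <= w + (r * p * t) ^+ 2 + p ^+ 2 * A.
  have -> : p * (t * `|r - H 1%N|) = `|r * p * t - H 1%N * (p * t)|.
    rewrite -[in LHS](ger0_norm (ltW t0)) -[in LHS](ger0_norm (ltW p0)) -!normrM.
    by congr `|_|; ring.
  have -> : r * p * t - H 1%N * (p * t) =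
    (1 - u - g) + (r * p * t - (1 - u)) + (g - H 1%N * (p * t)) by ring.
  apply: (le_trans (ler_normD _ _)); apply: lerD => //.
  apply: (le_trans (ler_normD _ _)); rewrite lerD2l ger0_norm; lra.
move=> h; rewrite -(ler_pM2l p0); apply: (le_trans h).
rewrite !exprMn; nra.
Qed.

(** A lower bound suffices here, so all terms of [gen_fun] but the first can be
    dropped. *)
Lemma var_at_zero C : (forall p, 0 < p <= 1 -> second_mean p <= p * C) ->
  t * (r + H 1%N ^+ 2) <= C.
Proof.
move=> hC; set X := t * _.
have X0 : 0 <= X by rewrite mulr_ge0 ?ltW // ltr_wpDr ?sqr_ge0.
apply: (@le_of_small _ C (t * X + (r * t) ^+ 2) (Num.min 1 t^-1)).
  by rewrite lt_min ltr01 invr_gt0.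
move=> p /andP[p0]; rewrite le_min => /andP[p1 pt].
have p01 : 0 <= p <= 1 by rewrite ltW.
have pt1 : 0 <= 1 - p * t by rewrite subr_ge0 -ler_pdivlMr // div1r.
have := gen_sqr_ge p01 2; have -> : partial (coef (fun i => H i ^+ 2) (p * t)) 2 =
    H 1%N ^+ 2 * (p * t).
  by rewrite /partial big_nat1 /coef (_ : 1`! = 1%N) // divr1 expr1.
have y0 : 0 <= r * p * t by rewrite !mulr_ge0 // ltW.
have /andP[+ _] := exp_small y0.
have := hC p; rewrite p0 p1 => /(_ isT); rewrite /second_mean.
have := expR_ge1Dx (- (p * t)).
set g := gen_fun _ _; set e := expR (- (p * t)); set u := expR _ => e1 sC u1 gA.
have gu : 0 <= 1 - u + g.
  apply: addr_ge0; last by apply: le_trans gA; rewrite mulr_ge0 ?sqr_ge0 // mulr_ge0 // ltW.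
  by rewrite subr_ge0 /u -expR0 ler_expR oppr_le0.
have h1 : (1 - p * t) * (1 - u + g) <= p * C.
  by apply: le_trans sC; rewrite ler_wpM2r.
have h2 : (1 - p * t) * (p * X - (r * p * t) ^+ 2) <= p * C.
  apply: le_trans h1; rewrite ler_wpM2l // /X; lra.
rewrite -(ler_pM2l p0).
have : 0 <= p * t * (r * p * t) ^+ 2 by rewrite mulr_ge0 ?sqr_ge0 // mulr_ge0 // ltW.
have -> : p * (C + p * (t * X + (r * t) ^+ 2)) =
    p * C + p * t * (p * X) + (r * p * t) ^+ 2 by ring.
move: h2; move: ((r * p * t) ^+ 2) => s; lra.
Qed.

End coefficient_series.

(** * The two-expedition model *)

Section model.
Context (R : realType) (S : countType) (mu : probability {fset S} R) (t t' : R).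
Context (M : poisson_model mu t t').
Hypotheses (t0 : 0 < t) (t'0 : 0 < t').

Lemma model_sampling (K : finType) (c : {fset S} -> K) :
  poissonized (pm_P M) (fun i w => c (pm_X M i w))
    (fun a => prob mu (c @^-1` [set a])) (pm_n M) (pm_m M) t t'.
Proof.
have mX i : discrete_rv (pm_X M i).
  by move=> A; rewrite -[X in measurable X]setTI; exact: measurable_funPT.
have mn : discrete_rv (pm_n M).
  by move=> A; rewrite -[X in measurable X]setTI; exact: measurable_funPT.
have mm : discrete_rv (pm_m M).
  by move=> A; rewrite -[X in measurable X]setTI; exact: measurable_funPT.
split=> // [i|i a|n0 m0 k C].
- exact: (discrete_rv_comp c (mX i)).
- by rewrite -probE // -(pm_X_law M i).
rewrite (pm_indep M [set n0] [set m0] (fun i => c @^-1` C i) k); congr (_ * _)%E.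
by rewrite EFinM -!poisE // -(pm_n_law M) -(pm_m_law M).
Qed.

Section observables.
Context (H : nat -> R) (H0 : H 0%N = 0).

Definition error (w : pm_Omega M) : R := new_species w - linear_estimator H w.

Lemma mseE : mse M H = (\int[pm_P M]_w (error w ^+ 2)%:E)%E.
Proof.
rewrite /mse unlock; apply: eq_integral => w _.
by rewrite real_normK // num_real.
Qed.

Lemma score_unseen : score H 0 0 = 0.
Proof. by rewrite /score H0 subr0. Qed.

Lemma error_sum w (U : {fset S}) :
  (forall s, (0 < count_first w s + count_second w s)%N -> s \in U) ->
  error w = \sum_(s <- U) score H (count_first w s) (count_second w s).
Proof.
move=> seenU.
have card_seen (Q : pred S) : (forall s, Q s -> s \in U) ->
    #|` fset_set [set s | Q s]|%:R = \sum_(s <- U) (Q s)%:R :> R.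
  move=> QU.
  have -> : fset_set [set s | Q s] = [fset s in U | Q s]%fset.
    apply/fsetP => s; rewrite in_fset_set; last first.
      by apply: (sub_finite_set _ (finite_fset U)) => u /= /QU.
    rewrite !inE /=; apply/idP/andP => [|[_ Qs]]; last by rewrite inE.
    by rewrite inE => Qs; split=> //; exact: QU.
  rewrite card_fset_sum1 natr_sum -big_fset_condE big_mkcond.
  by apply: eq_bigr => s _; case: ifP.
rewrite /error /new_species /seen_total /seen_first /linear_estimator.
rewrite (card_seen (fun s => 0 < count_first w s + count_second w s)%N) //.
rewrite (card_seen (fun s => 0 < count_first w s)%N) => [|s s0]; last first.
  by apply: seenU; rewrite addn_gt0 s0.
rewrite (fsbigE (enum_fset U)) //=; last first.
  move=> s _ sU; have : ~~ (0 < count_first w s + count_second w s)%N.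
    by apply: contra sU; exact: seenU.
  by rewrite -leqNgt leqn0 addn_eq0 => /andP[/eqP ->].
under [X in _ - _ - X]eq_bigl do rewrite in_setT.
rewrite -!sumrB; apply: eq_bigr => s _; rewrite /score; congr (_ - _).
by case: (count_first w s) => [|k]; rewrite ?add0n ?subr0 // addSn subrr.
Qed.

Definition seen_set w : {fset S} :=
  (\bigcup_(i <- iota 0 (pm_n M w + pm_m M w)) pm_X M i w)%fset.

Lemma seen_setP w s : (0 < count_first w s + count_second w s)%N ->
  s \in seen_set w.
Proof.
apply: contraTT => sN; rewrite -leqNgt leqn0 addn_eq0.
have out i : (i < pm_n M w + pm_m M w)%N -> (s \in pm_X M i w) = false.
  move=> ilt; apply: contraNF sN => sX; apply/bigfcupP; exists i => //.
  by rewrite mem_iota ilt.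
apply/andP; split; rewrite /count_first /count_second big_nat_cond big1 //.
  by move=> i /andP[/andP[_ ilt] _]; rewrite out // ltn_addr.
by move=> i /andP[/andP[_ ilt] _]; rewrite out.
Qed.

Lemma count_first_le w s : (count_first w s <= pm_n M w)%N.
Proof.
rewrite /count_first; apply: (@leq_trans (\sum_(0 <= i < pm_n M w) 1)%N).
  by apply: leq_sum => i _; exact: leq_b1.
by rewrite sum_nat_const_nat muln1 subn0.
Qed.

(** Species are numbered by [pickle]. Unseen species contribute nothing, so
    eventually the sum contains every nonzero term, and the cutoff is eventually
    above all counts. *)
Lemma error_pickle w : exists N0, forall N, (N0 <= N)%N ->
  error w = \sum_(i < N) (if choice.pickle_inv i is Some s then
    score (cutoff N H) (count_first w s) (count_second w s) else 0).
Proof.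
set U := seen_set w.
exists (maxn (pm_n M w) (\max_(s <- U) choice.pickle s).+1) => N.
rewrite geq_max => /andP[nN UN].
have pN s : s \in U -> (choice.pickle s < N)%N.
  by move=> sU; apply: leq_trans UN; rewrite ltnS; exact: leq_bigmax_seq.
rewrite (error_sum (@seen_setP w)) -/U.
set f := fun s => score H (count_first w s) (count_second w s).
have cutf s : score (cutoff N H) (count_first w s) (count_second w s) = f s.
  by rewrite /f /score /cutoff (leq_trans (count_first_le w s) nN).
have f0 s : s \notin U -> f s = 0.
  move=> sU; rewrite /f; have : ~~ (0 < count_first w s + count_second w s)%N.
    by apply: contra sU; exact: seen_setP.
  by rewrite -leqNgt leqn0 addn_eq0 => /andP[/eqP -> /eqP ->]; exact: score_unseen.
transitivity (\sum_(s <- U) \sum_(i < N) (choice.pickle s == i :> nat)%:R * f s).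
  rewrite big_seq [RHS]big_seq; apply: eq_bigr => s sU.
  rewrite (bigD1 (Ordinal (pN s sU))) //= eqxx mul1r big1 ?addr0 // => i.
  by rewrite -val_eqE /= eq_sym => /negbTE ->; rewrite mul0r.
rewrite exchange_big; apply: eq_bigr => i _.
case E : (choice.pickle_inv i) => [s0|]; last first.
  apply: big1_seq => s _; case: eqP => [e|]; last by rewrite mul0r.
  by move: E; rewrite -e choice.pickleK_inv.
have ps0 : choice.pickle s0 = i.
  by have := choice.pickle_invK (T := S) i; rewrite E.
have eqs s : (choice.pickle s == i :> nat) = (s == s0).
  by rewrite -ps0 (inj_eq (pcan_inj choice.pickleK_inv)).
under eq_bigr do rewrite eqs.
rewrite cutf; have [s0U|s0U] := boolP (s0 \in U).
  rewrite (big_fsetD1 s0) //= eqxx mul1r big_seq big1 ?addr0 // => s.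
  by rewrite !inE => /andP[/negbTE -> _]; rewrite mul0r.
rewrite f0 // big1_seq // => s /= sU; case: eqP => [e|]; last by rewrite mul0r.
by rewrite -e sU in s0U.
Qed.

End observables.
End model.

(** * Upper bound on the mean square error *)

Section upper_bound.
Context (R : realType) (S : countType) (mu : probability {fset S} R) (r t : R).
Context (M : poisson_model mu t (r * t)).
Hypotheses (r0 : 0 < r) (t0 : 0 < t).
Context (H : nat -> R) (H0 : H 0%N = 0) (fin : energy_finite t H).

Let rt0 : 0 < r * t. Proof. exact: mulr_gt0. Qed.

(** The species of a sample among the first [N] in the numbering by [pickle]. *)
Definition trace (N : nat) (A : {fset S}) : {set 'I_N} :=
  [set i : 'I_N | if choice.pickle_inv i is Some s then s \in A else false].

Definition containing (N : nat) (i : 'I_N) : {pred {set 'I_N}} :=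
  [pred a : {set 'I_N} | i \in a].

Definition truncated_error (N : nat) (w : pm_Omega M) : R :=
  score_sum (fun i w => trace N (pm_X M i w)) (pm_n M) (pm_m M) N H
    (@containing N) w.

Lemma truncated_errorE N w : truncated_error N w =
  \sum_(i < N) (if choice.pickle_inv i is Some s then
    score (cutoff N H) (count_first w s) (count_second w s) else 0).
Proof.
apply: eq_bigr => i _; rewrite /count_in /count_in'.
case E : (choice.pickle_inv i) => [s|]; last first.
  rewrite !big1; last 2 first.
  - by move=> k _; rewrite !inE E.
  - by move=> k _; rewrite !inE E.
  exact: score_unseen (cutoff0 N H0).
by congr score; apply: eq_bigr => k _; rewrite !inE E.
Qed.

Lemma error_truncated w : \forall N \near \oo, truncated_error N w = error H w.
Proof.
have [N0 h] := error_pickle H0 w.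
by near=> N; rewrite truncated_errorE; apply/esym/h; near: N; exact: nbhs_infty_ge.
Unshelve. all: by end_near. Qed.

Lemma card_trace N A : (#|trace N A| <= #|` A|)%N.
Proof.
rewrite cardE -(size_map val) -(size_map (@choice.pickle S) (enum_fset A)).
apply: uniq_leq_size; first by rewrite map_inj_uniq ?enum_uniq //; exact: val_inj.
move=> _ /mapP[i + ->]; rewrite mem_enum inE.
case E : (choice.pickle_inv i) => [s|] // sA.
apply/mapP; exists s => //.
by have := choice.pickle_invK (T := S) i; rewrite E.
Qed.

Lemma null_points (D : set {fset S}) :
  (forall A, D A -> mu [set A] = 0%E) -> mu D = 0%E.
Proof.
move=> h; apply/negligibleP => //.
have -> : D = \bigcup_k (if choice.unpickle k is Some A then
    (if `[< D A >] then [set A] else set0) else set0).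
  apply/seteqP; split => [A DA|A [k _]].
    by exists (choice.pickle A) => //; rewrite choice.pickleK; case: asboolP.
  by case: choice.unpickle => // A'; case: asboolP => //= DA ->.
apply: negligible_bigcup => k; case: choice.unpickle => [A|]; last exact: negligible_set0.
case: asboolP => DA; last exact: negligible_set0.
by apply/negligibleP => //; exact: h.
Qed.

Context (B : nat) (muB : sample_card_le B mu).

Definition trace_law N a : R := prob mu (trace N @^-1` [set a]).

(** A trace is no larger than the sample it comes from, so larger traces come
    from a countable set of samples of probability zero. *)
Lemma trace_small N a : trace_law a != 0 -> (#|a : {set 'I_N}| <= B)%N.
Proof.
apply: contraNT; rewrite -ltnNge => Ba; apply/eqP/prob_eq/null_points => A /= tA.
by apply: muB; apply: leq_trans (card_trace N A); rewrite tA.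
Qed.

Let sampling N : poissonized (pm_P M) (fun i w => trace N (pm_X M i w))
  (@trace_law N) (pm_n M) (pm_m M) t (r * t) := model_sampling M t0 rt0 (trace N).

Lemma species_prob01 N i : 0 <= class_prob (@trace_law N) (containing i) <= 1.
Proof.
have q0 a : 0 <= @trace_law N a := letter_ge0 (sampling N) a.
apply/andP; split; first exact: sumr_ge0.
rewrite -(letter_sum1 (sampling N)) [leRHS](bigID (fun a => a \in containing i)) /=.
by rewrite lerDl; apply: sumr_ge0 => a _; exact: q0.
Qed.

(** The sum is the expected size of a trace. *)
Lemma sum_species_prob N : \sum_i class_prob (@trace_law N) (containing i) <= B%:R.
Proof.
rewrite /class_prob (exchange_big_dep xpredT) //=.
rewrite -[leRHS]mulr1 -[X in _ <= _ * X](letter_sum1 (sampling N)) mulr_sumr.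
apply: ler_sum => a _; rewrite sumr_const -[leLHS]mulr_natl.
have [->|qa] := eqVneq (trace_law a) 0; first by rewrite !mulr0.
apply: ler_wpM2r; first exact: letter_ge0 (sampling N) a.
rewrite ler_nat.
by apply: leq_trans (trace_small qa); apply: subset_leq_card; apply/fintype.subsetP.
Qed.

Context (yb yv : R) (yb0 : 0 <= yb) (yv0 : 0 <= yv).
Hypothesis bias_le : forall p, 0 <= p <= 1 -> `|bias_mean r t H p| <= p * yb.
Hypothesis var_le : forall p, 0 <= p <= 1 -> second_mean r t H p <= p * yv.

Lemma truncated_le N :
  (\int[pm_P M]_w (truncated_error N w ^+ 2)%:E <=
   ((B%:R * (yb + (abs_total t H - partial (abs_coef t H) N.+1))) ^+ 2
    + B%:R * (B%:R * yv))%:E)%E.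
Proof.
have d0 : 0 <= abs_total t H - partial (abs_coef t H) N.+1.
  by rewrite subr_ge0 abs_total_ge.
apply: le_trans (integral_score_sum_le (B := B) (sampling N) (ltW t0) (ltW rt0)
  N H0 _) _.
  move=> a qa; apply: leq_trans (trace_small qa).
  by apply: subset_leq_card; apply/fintype.subsetP.
rewrite lee_fin; apply: lerD.
  rewrite -[leLHS]real_normK ?num_real //; apply: lerXn2r; rewrite ?nnegrE ?normr_ge0 //.
    by rewrite mulr_ge0 // addr_ge0.
  apply: (le_trans (ler_norm_sum _ _ _)).
  apply: (@le_trans _ _ (\sum_i class_prob (@trace_law N) (containing i) *
      (yb + (abs_total t H - partial (abs_coef t H) N.+1)))).
    apply: ler_sum => i _; have p01 := species_prob01 i.
    apply: (le_trans (mean_approx r t0 H0 fin N p01)).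
    by rewrite [leRHS]mulrDr lerD2r bias_le.
  by rewrite -mulr_suml; apply: ler_wpM2r; [exact: addr_ge0|exact: sum_species_prob].
rewrite ler_wpM2l //.
apply: (@le_trans _ _ (\sum_i class_prob (@trace_law N) (containing i) * yv)).
  apply: ler_sum => i _; have p01 := species_prob01 i.
  by apply: le_trans (var_le p01); exact: second_le.
by rewrite -mulr_suml; apply: ler_wpM2r => //; exact: sum_species_prob.
Qed.

(** The truncated errors converge pointwise to the error because they are
    eventually equal to it, and Fatou's lemma transfers the bound. *)
Lemma mse_upper : (mse M H <= (B%:R ^+ 2 * (yb ^+ 2 + yv))%:E)%E.
Proof.
rewrite mseE.
have -> : (\int[pm_P M]_w (error H w ^+ 2)%:E =
    \int[pm_P M]_w limn_einf (fun N => (truncated_error N w ^+ 2)%:E))%E.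
  apply: eq_integral => w _; apply/esym.
  apply: (cvg_limn_einf_sup _).1; apply: cvg_near_cst.
  by have := error_truncated w; apply: filterS => N ->.
apply: le_trans (fatou _ _ _ _) _ => //.
- by move=> N; exact: (measurable_score_sum_sqr (sampling N) N H (@containing N)).
- by move=> N w _; rewrite lee_fin sqr_ge0.
apply: (limn_einf_le_cvg truncated_le); apply: cvg_EFin.
  by apply: nearW.
have -> : B%:R ^+ 2 * (yb ^+ 2 + yv) =
    (B%:R * (yb + (abs_total t H - abs_total t H))) ^+ 2 + B%:R * (B%:R * yv).
  by ring.
have h : (fun N => B%:R * (yb + (abs_total t H - partial (abs_coef t H) N.+1)))
    @ \oo --> B%:R * (yb + (abs_total t H - abs_total t H)).
  apply: cvgMr; apply: cvgD; first exact: cvg_cst.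
  apply: cvgB; first exact: cvg_cst.
  by have := abs_total_cvg t0 fin; rewrite -cvg_shiftS.
by apply: cvgD; [exact: (cvgM h h)|exact: cvg_cst].
Qed.

End upper_bound.

(** * Sampling from the unit interval *)

Section unit_interval.
Context (R : realType).
Local Notation leb := (@lebesgue_measure R).
Local Notation RT := (measurableTypeR R).

Definition rescale (a c : R) (x : RT) : RT := (x - a) / c.

Lemma measurable_rescale a c : measurable_fun setT (rescale a c).
Proof.
apply: measurable_funM; last exact: measurable_cst.
by apply: measurable_funB; [exact: measurable_id|exact: measurable_cst].
Qed.

(** Both sides are measures in [A] after division by [c], and they agree on
    intervals. *)
Lemma lebesgue_rescale a c (A : set RT) : 0 < c -> measurable A ->
  leb (rescale a c @^-1` A) = (c%:E * leb A)%E.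
Proof.
move=> c0 mA.
pose f := rescale a c.
have ci0 : 0 <= c^-1 by rewrite invr_ge0 ltW.
pose m := mscale (NngNum ci0) (pushforward leb f).
have e : leb A = m (@measurable_rescale a c) A.
  apply: lebesgue_measure_unique => // _ [[u v] /= _ <-].
  rewrite /m /mscale /= /pushforward.
  have -> : f @^-1` `]u, v]%classic = `]a + c * u, a + c * v]%classic.
    apply/seteqP; split=> x; rewrite /= !in_itv /= /rescale
      ltr_pdivlMr // ler_pdivrMr // => /andP[h1 h2]; apply/andP; split; lra.
  rewrite !lebesgue_measure_itv /= !lte_fin ltrD2l ltr_pM2l //.
  case: ifP => _; last by rewrite mule0.
  rewrite -!EFinB -EFinM; congr (_%:E); field; exact: lt0r_neq0.
rewrite e /m /mscale /= muleA -EFinM mulfV ?mul1e //; exact: lt0r_neq0.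
Qed.

Definition unit_prob : set RT -> \bar R :=
  mrestr leb (measurable_itv `[0%R, 1%R[ : measurable (`[0%R, 1%R[%classic : set RT)).

HB.instance Definition _ := Measure.on unit_prob.

Let unit_probT : unit_prob setT = 1%E.
Proof.
by rewrite /unit_prob /mrestr setTI lebesgue_measure_itv /= lte_fin ltr01 sube0.
Qed.

HB.instance Definition _ := Measure_isProbability.Build _ _ R unit_prob unit_probT.

Context (w : nat -> R).
Hypothesis w_ge0 : forall j, 0 <= w j.
Hypothesis w_sum1 : (fun n => \sum_(i < n) w i) @ \oo --> (1 : R).

Definition left_end (j : nat) : R := \sum_(i < j) w i.

(** Consecutive intervals of lengths [w 0, w 1, ...], which fill [0, 1[. *)
Definition block (j : nat) : set RT := `[left_end j, left_end j.+1[%classic.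

Lemma left_endS j : left_end j.+1 = left_end j + w j.
Proof. by rewrite /left_end big_ord_recr. Qed.

Lemma left_end_le i j : (i <= j)%N -> left_end i <= left_end j.
Proof.
elim: j => [|j IH]; first by rewrite leqn0 => /eqP ->.
rewrite leq_eqVlt ltnS => /orP[/eqP -> //|/IH h].
by rewrite left_endS; apply: le_trans h _; rewrite lerDl.
Qed.

Lemma left_end_le1 j : left_end j <= 1.
Proof.
rewrite -(cvg_lim (@Rhausdorff R) w_sum1).
by apply: (nondecreasing_cvgn_le left_end_le); exact: cvgP w_sum1.
Qed.

Lemma block_inj i j x : block i x -> block j x -> i = j.
Proof.
rewrite /block /= !in_itv /= => /andP[i1 i2] /andP[j1 j2].
have [ij|ji|//] := ltngtP i j.
  by have h := left_end_le ij; have := le_lt_trans (le_trans h j1) i2; rewrite ltxx.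
by have h := left_end_le ji; have := le_lt_trans (le_trans h i1) j2; rewrite ltxx.
Qed.

Lemma block_cover (x : RT) : 0 <= x < 1 -> exists j, block j x.
Proof.
move=> /andP[x0 x1].
have : exists n, x < left_end n.
  have [N _ h] : \forall n \near \oo, x < left_end n.
    exact: (cvgr_gt 1 w_sum1).
  by exists N; exact: h (leqnn N).
move=> ex; case: (ex_minnP ex) => -[|n] xn hmin.
  by move: xn; rewrite /left_end big_ord0; lra.
exists n; rewrite /block /= in_itv /= xn andbT leNgt; apply/negP => /hmin.
by rewrite ltnn.
Qed.

Definition block_index (x : RT) : nat := xget 0%N [set j | block j x].

Lemma block_indexP j x : block j x -> block_index x = j.
Proof.
move=> jx; rewrite /block_index; case: xgetP => [i -> /= ix|/(_ j) //].
exact: block_inj ix jx.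
Qed.

Lemma discrete_block_index : discrete_rv block_index.
Proof.
apply: discrete_rv_fibres => j.
have mb : measurable (\bigcup_i block i).
  by apply: bigcupT_measurable => i; exact: measurable_itv.
have -> : block_index @^-1` [set j] =
    block j `|` (if j == 0%N then ~` (\bigcup_i block i) else set0).
  apply/seteqP; split=> [x /= <-|x [/block_indexP //|]].
    have [[i ix]|nx] := pselect (exists i, block i x).
      by left; rewrite (block_indexP ix).
    right; have -> : block_index x = 0%N.
      by rewrite /block_index; case: xgetP => // i _ ix; case: nx; exists i.
    by move=> [i _ ix]; apply: nx; exists i.
  case: eqP => // -> nx /=; rewrite /block_index; case: xgetP => // i _ ix.
  by case: nx; exists i.
apply: measurableU; first exact: measurable_itv.
by case: ifP => _; [exact: measurableC|exact: measurable0].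
Qed.

(** The relative position of a point in its block. *)
Definition renew (x : RT) : RT :=
  rescale (left_end (block_index x)) (w (block_index x)) x.

Lemma measurable_renew : measurable_fun setT renew.
Proof.
move=> _ A mA; rewrite setTI.
have -> : renew @^-1` A = \bigcup_j (block_index @^-1` [set j] `&`
    rescale (left_end j) (w j) @^-1` A).
  apply/seteqP; split=> [x xA|x [j _ [/= <-]]//]; first by exists (block_index x).
apply: bigcupT_measurable => j; apply: measurableI; first exact: discrete_block_index.
by rewrite -[X in measurable X]setTI; exact: measurable_rescale.
Qed.

Lemma unit_prob_block j (E : set RT) : measurable E ->
  unit_prob (block_index @^-1` [set j] `&` renew @^-1` E) =
  ((w j)%:E * unit_prob E)%E.
Proof.
move=> mE; rewrite /unit_prob /mrestr.
have [wj|wj] := eqVneq (w j) 0.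
  rewrite wj mul0e (_ : _ `&` _ = set0) ?measure0 //.
  apply/seteqP; split=> // x [[/= xj _]]; rewrite /= in_itv /= => /block_cover[i ix].
  move: (ix); rewrite -(block_indexP ix) xj /block /= in_itv /= left_endS wj; lra.
have w0 : 0 < w j by rewrite lt_neqAle eq_sym wj w_ge0.
rewrite -(lebesgue_rescale (left_end j) w0); last first.
  by apply: measurableI => //; exact: measurable_itv.
congr (leb _); apply/seteqP; split=> x /=.
  move=> [[xj xE]]; rewrite in_itv /= => /block_cover[i ix].
  have ij : i = j by rewrite -xj (block_indexP ix).
  move: ix xE; rewrite ij /renew xj /block /= in_itv /= left_endS.
  move=> /andP[h1 h2] xE; split=> //; rewrite in_itv /= /rescale.
  by rewrite divr_ge0 ?subr_ge0 ?(ltW w0) //= ltr_pdivrMr // mul1r ltrBlDl.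
move=> [xE]; rewrite in_itv /= /rescale => /andP[h1 h2].
have bx : block j x.
  rewrite /block /= in_itv /= left_endS.
  move: h1 h2; rewrite ler_pdivlMr // ltr_pdivrMr // => h1 h2.
  by apply/andP; split; lra.
rewrite /renew (block_indexP bx); split; first by split.
move: bx; rewrite /block /= !in_itv /= => /andP[b1 b2].
have := left_end_le (leq0n j); rewrite /left_end big_ord0 -/(left_end j) => l0.
have := left_end_le1 j.+1; rewrite -/(left_end j.+1) => l1; apply/andP; split; lra.
Qed.

Lemma unit_prob_index j : unit_prob (block_index @^-1` [set j]) = (w j)%:E.
Proof.
have := unit_prob_block j (@measurableT _ RT).
by rewrite preimage_setT setIT probability_setT mule1.
Qed.

(** The block index and the relative position are independent, and the latter
    is again uniform. *)
Lemma unit_prob_split (A : set nat) (E : set RT) : measurable E ->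
  unit_prob (block_index @^-1` A `&` renew @^-1` E) =
  (unit_prob (block_index @^-1` A) * unit_prob E)%E.
Proof.
move=> mE.
have mr : measurable (renew @^-1` E).
  by rewrite -[X in measurable X]setTI; exact: measurable_renew.
have eA F : block_index @^-1` A `&` F =
    \bigcup_(j in A) (block_index @^-1` [set j] `&` F).
  by apply/seteqP; split=> [x [xA xF]|x [j jA [/= xj xF]]];
    [exists (block_index x)|split=> //=; rewrite xj].
have tr F : trivIset A (fun j => block_index @^-1` [set j] `&` F).
  by move=> i j _ _ [x [[/= <- _] [/= <- _]]].
rewrite eA measure_bigcup //; last first.
  by move=> j _; apply: measurableI => //; exact: discrete_block_index.
rewrite -[block_index @^-1` A]setIT eA measure_bigcup //; last first.
  by move=> j _; apply: measurableI => //; exact: discrete_block_index.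
rewrite muleC; have -> : unit_prob E = (fine (unit_prob E))%:E.
  by rewrite fineK // fin_num_measure.
rewrite -nneseriesZl //; apply: eq_eseriesr => j _.
transitivity ((w j)%:E * unit_prob E)%E; first exact: unit_prob_block.
rewrite fineK ?fin_num_measure // setIT muleC; congr (_ * _)%E.
exact/esym/unit_prob_index.
Qed.

Lemma unit_prob_renew (E : set RT) : measurable E ->
  unit_prob (renew @^-1` E) = unit_prob E.
Proof.
move=> mE; have := unit_prob_split setT mE.
by rewrite preimage_setT setTI probability_setT mul1e.
Qed.

End unit_interval.

(** * Realization of a prescribed discrete law *)

Section realization.
Context (R : realType) (S : countType) (t t' : R) (g : nat -> {fset S}).
Context (w : nat -> R).
Hypotheses (t0 : 0 < t) (t'0 : 0 < t').
Hypothesis w_ge0 : forall j, 0 <= w j.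
Hypothesis w_sum1 : (fun n => \sum_(i < n) w i) @ \oo --> (1 : R).
Local Notation RT := (measurableTypeR R).
Local Notation U := (@unit_prob R).

Lemma pois_sum1 (s : R) : (fun n => \sum_(i < n) pois s i) @ \oo --> (1 : R).
Proof.
have -> : (fun n => \sum_(i < n) pois s i) =
    (fun n => expR (- s) * series (exp_coeff s) n).
  apply/funext => n; rewrite /series /= mulr_sumr big_mkord.
  by apply: eq_bigr => i _; rewrite /pois exp_coeffE /= mulrC [in RHS]mulrC [_^-1 * _]mulrC.
rewrite [X in _ --> X](_ : _ = expR (- s) * expR s); last first.
  by rewrite -expRD addNr expR0.
by apply: cvgMr; exact: is_cvg_series_exp_coeff.
Qed.

Let pt0 j : 0 <= pois t j. Proof. by rewrite pois_ge0 // ltW. Qed.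
Let pt'0 j : 0 <= pois t' j. Proof. by rewrite pois_ge0 // ltW. Qed.

Definition first_number (x : RT) : nat := block_index (pois t) x.
Definition second_number (x : RT) : nat :=
  block_index (pois t') (renew (pois t) x).
Definition fresh (i : nat) (x : RT) : RT :=
  iter i (renew w) (renew (pois t') (renew (pois t) x)).
Definition sample (i : nat) (x : RT) : {fset S} := g (block_index w (fresh i x)).

Lemma preimage_renew (v : nat -> R) (E : set RT) :
  (forall j, 0 <= v j) -> measurable E -> measurable (renew v @^-1` E).
Proof.
by move=> v0 mE; rewrite -[X in measurable X]setTI; exact: measurable_renew.
Qed.

Lemma iter_renew_measurable i (E : set RT) :
  measurable E -> measurable (iter i (renew w) @^-1` E).
Proof.
move=> mE; elim: i => //= i IH.
have -> : (fun x => renew w (iter i (renew w) x)) @^-1` E =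
    renew w @^-1` (iter i (renew w) @^-1` E).
  by apply/seteqP; split=> x /=; rewrite -iterS iterSr.
exact: preimage_renew.
Qed.

Lemma iter_renew_prob i (E : set RT) :
  measurable E -> U (iter i (renew w) @^-1` E) = U E.
Proof.
move=> mE; elim: i => //= i IH; rewrite -[RHS]IH.
rewrite -[RHS](unit_prob_renew w_ge0 w_sum1); last exact: iter_renew_measurable.
by congr (U _); apply/seteqP; split=> x /=; rewrite -iterS iterSr.
Qed.

Lemma discrete_first_number : discrete_rv first_number.
Proof. exact: discrete_block_index pt0. Qed.

Lemma discrete_second_number : discrete_rv second_number.
Proof.
move=> A; apply: (@preimage_renew (pois t) (block_index (pois t') @^-1` A)) => //.
exact: discrete_block_index pt'0 A.
Qed.

Lemma discrete_sample i : discrete_rv (sample i).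
Proof.
move=> A.
apply: (@preimage_renew (pois t) (renew (pois t') @^-1`
  (iter i (renew w) @^-1` (block_index w @^-1` (g @^-1` A))))) => //.
apply: preimage_renew => //; apply: iter_renew_measurable.
exact: discrete_block_index.
Qed.

Lemma second_number_prob A :
  U (second_number @^-1` A) = U (block_index (pois t') @^-1` A).
Proof.
exact: (unit_prob_renew pt0 (@pois_sum1 t) (discrete_block_index pt'0 A)).
Qed.

Lemma sample_prob i (C : set {fset S}) :
  U (sample i @^-1` C) = U (block_index w @^-1` (g @^-1` C)).
Proof.
have mC : measurable (block_index w @^-1` (g @^-1` C)).
  exact: discrete_block_index.
rewrite -[RHS](iter_renew_prob i mC).
have mi := iter_renew_measurable i mC.
rewrite -[RHS](unit_prob_renew pt'0 (@pois_sum1 t') mi).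
rewrite -[RHS](unit_prob_renew pt0 (@pois_sum1 t)) //.
exact: preimage_renew.
Qed.

(** The event that the successive blocks hit the prescribed sets, seen from a
    point that has not been renewed yet. *)
Definition sample_event k (C : nat -> set {fset S}) : set RT :=
  [set x | forall i, (i < k)%N -> C i (g (block_index w (iter i (renew w) x)))].

Lemma sample_eventS k C : sample_event k.+1 C =
  block_index w @^-1` (g @^-1` C 0%N) `&`
  renew w @^-1` sample_event k (fun i => C i.+1).
Proof.
apply/seteqP; split=> x /=.
  move=> h; split; first exact: (h 0%N).
  by move=> i ik; have := h i.+1 ik; rewrite iterSr.
by move=> [h0 h] [|i] ik //; rewrite iterSr; exact: h.
Qed.

Lemma sample_event_measurable k C : measurable (sample_event k C).
Proof.
elim: k C => [|k IH] C.
  by rewrite (_ : sample_event 0 C = setT) //; apply/seteqP; split.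
rewrite sample_eventS; apply: measurableI; first exact: discrete_block_index.
exact: preimage_renew.
Qed.

Lemma sample_event_prob k C : U (sample_event k C) =
  (\prod_(i < k) U (block_index w @^-1` (g @^-1` C i)))%E.
Proof.
elim: k C => [|k IH] C.
  rewrite big_ord0 (_ : sample_event 0 C = setT) ?probability_setT //.
  by apply/seteqP; split.
rewrite sample_eventS unit_prob_split //; last exact: sample_event_measurable.
by rewrite IH big_ord_recl.
Qed.

Lemma realization_independent (A B : set nat) (C : nat -> set {fset S}) k :
  U (first_number @^-1` A `&` second_number @^-1` B `&`
     \bigcap_(i < k) (sample i @^-1` C i)) =
  (U (first_number @^-1` A) * U (second_number @^-1` B) *
   \prod_(i < k) U (sample i @^-1` C i))%E.
Proof.
have mE := sample_event_measurable k C.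
have -> : first_number @^-1` A `&` second_number @^-1` B `&`
    \bigcap_(i < k) (sample i @^-1` C i) =
    block_index (pois t) @^-1` A `&` renew (pois t) @^-1`
      (block_index (pois t') @^-1` B `&` renew (pois t') @^-1` sample_event k C).
  by apply/seteqP; split=> x /= => [[[]]|[? []]].
rewrite (unit_prob_split pt0 (@pois_sum1 t)); last first.
  by apply: measurableI; [exact: discrete_block_index|exact: preimage_renew].
rewrite (unit_prob_split pt'0 (@pois_sum1 t')) // sample_event_prob.
rewrite second_number_prob -muleA; congr (_ * (_ * _))%E.
by apply: eq_bigr => i _; rewrite sample_prob.
Qed.

Lemma realization_exists : exists (mu : probability {fset S} R)
    (M : poisson_model mu t t'),
  (forall C, mu C = U (block_index w @^-1` (g @^-1` C))) /\
  (forall i (x : pm_Omega M), exists k, pm_X M i x = g k).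
Proof.
pose X i : {RV U >-> {fset S}} :=
  mfun_Sub (mem_set (discrete_rv_measurable (discrete_sample i))).
pose n : {RV U >-> nat} :=
  mfun_Sub (mem_set (discrete_rv_measurable discrete_first_number)).
pose m : {RV U >-> nat} :=
  mfun_Sub (mem_set (discrete_rv_measurable discrete_second_number)).
have law_X i C : distribution U (X i) C = distribution U (X 0%N) C.
  transitivity (U (sample i @^-1` C)) => //; rewrite sample_prob.
  exact/esym/sample_prob.
have law_n k : distribution U n [set k] = (poisson_pmf t k)%:E.
  by rewrite poisE //; exact: (unit_prob_index pt0 (@pois_sum1 t)).
have law_m k : distribution U m [set k] = (poisson_pmf t' k)%:E.
  rewrite poisE //; transitivity (U (second_number @^-1` [set k])) => //.
  by rewrite second_number_prob; exact: (unit_prob_index pt'0 (@pois_sum1 t')).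
exists (distribution U (X 0%N)).
exists (PoissonModel law_X law_n law_m realization_independent).
split=> [C|i x]; first exact: sample_prob.
by exists (block_index w (fresh i x)).
Qed.

End realization.

(** * Groups of inseparable species *)

Section grouped.
Context (R : realType) (t t' : R) (B m : nat) (p : 'I_m -> R).
Hypotheses (t0 : 0 < t) (t'0 : 0 < t') (B0 : (0 < B)%N).
Hypotheses (p_ge0 : forall j, 0 <= p j) (p_le1 : \sum_j p j <= 1).

Local Notation S := ('I_m * 'I_B)%type.

(** [m] groups of [B] inseparable species; any further index is an empty
    sample. *)
Definition group (j : 'I_m) : {fset S} :=
  [fset s in [seq (j, b) | b <- enum 'I_B]]%fset.

Definition group_sample (k : nat) : {fset S} :=
  if insub k is Some j then group j else fset0.

Definition group_weight (k : nat) : R :=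
  if insub k is Some j then p j else
  if k == m then 1 - \sum_j p j else 0.

Lemma in_group j s : (s \in group j) = (s.1 == j).
Proof.
case: s => j' b; rewrite inE; apply/mapP/eqP => /= [[b' _ [-> _]] //|->].
by exists b; rewrite ?mem_enum.
Qed.

Lemma in_group_sample k s : (s \in group_sample k) = (s.1 == k :> nat).
Proof.
rewrite /group_sample; case: insubP => [j _ <-|].
  by rewrite in_group -val_eqE.
rewrite inE -leqNgt => mk; apply/esym/negbTE/eqP => e.
by have := ltn_ord s.1; rewrite e ltnNge mk.
Qed.

Lemma card_group j : #|` group j| = B.
Proof.
have u : uniq [seq (j, b) | b <- enum 'I_B].
  by rewrite map_inj_uniq ?enum_uniq // => b b' [].
by rewrite /group card_fseq undup_id // size_map size_enum_ord.
Qed.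

Lemma group_weight_ge0 k : 0 <= group_weight k.
Proof.
rewrite /group_weight; case: insub => [j|] //.
by case: ifP => // _; rewrite subr_ge0.
Qed.

Lemma group_weight_ord (j : 'I_m) : group_weight j = p j.
Proof. by rewrite /group_weight valK. Qed.

Lemma group_weight_sum1 :
  (fun n => \sum_(i < n) group_weight i) @ \oo --> (1 : R).
Proof.
apply: cvg_near_cst; near=> n.
have mn : (m < n)%N by near: n; exact: nbhs_infty_gt.
rewrite -(big_mkord xpredT) (big_cat_nat (leq0n m) (ltnW mn)) /= big_mkord.
rewrite (eq_bigr p) => [|j _]; last exact: group_weight_ord.
rewrite big_ltn // [X in _ + (_ + X)]big_nat_cond.
rewrite [X in _ + (_ + X)]big1 => [|i /andP[/andP[mi _] _]].
  by rewrite /group_weight insubF ?ltnn // eqxx addr0 addrC subrK.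
rewrite /group_weight insubF; last by rewrite ltnNge ltnW.
by rewrite gtn_eqF.
Unshelve. all: by end_near. Qed.

(** Recovers the index of a group from the sample. *)
Definition group_of (A : {fset S}) : option 'I_m :=
  [pick j | [exists b, (j, b) \in A]].

Lemma group_of_sample k : group_of (group_sample k) = insub k.
Proof.
rewrite /group_of; case: pickP => [j /existsP[b]|none].
  by rewrite in_group_sample /= => /eqP <-; rewrite valK.
case: insubP => // j _ jk; have := none j; move/negbT/existsPn.
by move=> /(_ (Ordinal B0)); rewrite in_group_sample /= jk eqxx.
Qed.

Lemma group_model_exists : exists (mu : probability {fset S} R)
    (M : poisson_model mu t t'),
  [/\ sample_card_le B mu, \sum_j p j = 1 -> sample_nonempty mu,
     forall j, prob mu (group_of @^-1` [set Some j]) = p j &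
     forall H : nat -> R, H 0%N = 0 -> forall w : pm_Omega M,
       let Y i w := group_of (pm_X M i w) in
       error H w = B%:R * \sum_j score H
         (count_in Y (pm_n M) (pred1 (Some j)) w)
         (count_in' Y (pm_n M) (pm_m M) (pred1 (Some j)) w)].
Proof.
have [mu [M [law range]]] := realization_exists group_sample t0 t'0
  group_weight_ge0 group_weight_sum1.
have lawk := unit_prob_index group_weight_ge0 group_weight_sum1.
exists mu, M; split.
- move=> A BA; rewrite law (_ : _ @^-1` _ = set0) ?measure0 //.
  apply/seteqP; split=> // x /= xA; move: BA; rewrite -xA /group_sample.
  by case: insub => [j|]; rewrite ?card_group ?cardfs0 // ltnn.
- move=> p1; rewrite /sample_nonempty law.
  apply/negligibleP; first exact: discrete_block_index group_weight_ge0 _.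
  apply: (@negligibleS _ _ _ _ (\bigcup_k (if (m <= k)%N then
      block_index group_weight @^-1` [set k] else set0))).
    move=> x /= xg; exists (block_index group_weight x) => //.
    case: leqP => // km; move: xg; rewrite /group_sample.
    case: insubP => [j _ _ /fsetP /(_ (j, Ordinal B0))|].
      by rewrite in_group eqxx inE.
    by rewrite km.
  apply: negligible_bigcup => k; case: leqP => mk; last exact: negligible_set0.
  apply/negligibleP; first exact: discrete_block_index group_weight_ge0 _.
  transitivity (group_weight k)%:E; first exact: lawk.
  rewrite /group_weight insubF; last by rewrite ltnNge mk.
  by case: ifP => // _; rewrite p1 subrr.
- move=> j; apply: prob_eq; rewrite law -(group_weight_ord j) -lawk.
  congr (unit_prob _); apply/seteqP; split=> x /=; rewrite group_of_sample.
    by case: insubP => // i _ <- [->].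
  by move=> ->; rewrite valK.
- move=> H H0 w Y.
  have mem i (s : S) : (s \in pm_X M i w) = (Y i w == Some s.1).
    rewrite /Y; have [k ->] := range i w; rewrite in_group_sample group_of_sample.
    case: insubP => [j _ <-|].
      by rewrite (inj_eq (@Some_inj _)) val_eqE eq_sym.
    by move=> mk; apply/negbTE/eqP => e; move: mk; rewrite -e ltn_ord.
  rewrite (error_sum H0 (U := [fset s in enum (predT : pred S)]%fset)); last first.
    by move=> s _; rewrite inE mem_enum.
  rewrite (perm_big (enum (predT : pred S))) /=; last first.
    apply: uniq_perm; rewrite ?fset_uniq ?enum_uniq // => s.
    by rewrite inE !mem_enum.
  rewrite big_enum /=.
  transitivity (\sum_(j : 'I_m) \sum_(b : 'I_B) score H
      (count_in Y (pm_n M) (pred1 (Some j)) w)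
      (count_in' Y (pm_n M) (pm_m M) (pred1 (Some j)) w)).
    rewrite pair_big; apply: eq_bigr => -[j b] _ /=.
    congr score; first by apply: eq_bigr => i _; rewrite mem.
    by apply: eq_bigr => i _; rewrite mem.
  rewrite mulr_sumr; apply: eq_bigr => j _.
  by rewrite sumr_const card_ord mulr_natl.
Qed.

End grouped.

(** * Exact mean square error for disjoint classes *)

Section full_score_sums.
Context d (Om : measurableType d) (R : realType) (P : probability Om R).
Context (K : finType) (Y : nat -> Om -> K) (q : K -> R).
Context (n m : Om -> nat) (r t : R).
Hypothesis sampling : poissonized P Y q n m t (r * t).
Hypotheses (r0 : 0 < r) (t0 : 0 < t).
Context (H : nat -> R) (H0 : H 0%N = 0).
Context (I : finType) (T : I -> {pred K}).

Let rt0 : 0 <= r * t. Proof. by rewrite mulr_ge0 // ltW. Qed.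

Definition class_error (i : I) w : R :=
  score H (count_in Y n (T i) w) (count_in' Y n m (T i) w).

Lemma discrete_class_counts i :
  discrete_rv (fun w => (count_in Y n (T i) w, count_in' Y n m (T i) w)).
Proof.
apply: discrete_rv_pair.
  have mf := discrete_first_counts (letters_discrete sampling) (first_discrete sampling).
  have := discrete_rv_comp (fun k : {ffun K -> nat} => (\sum_(a in T i) k a)%N) mf.
  by congr discrete_rv; apply/funext => w; rewrite (count_inE Y n m).
have ms := discrete_second_counts (letters_discrete sampling)
  (first_discrete sampling) (second_discrete sampling).
have := discrete_rv_comp (fun k : {ffun K -> nat} => (\sum_(a in T i) k a)%N) ms.
by congr discrete_rv; apply/funext => w; rewrite count_in'E.
Qed.

Lemma discrete_of_class_counts (U : Type) (phi : {ffun I -> nat * nat} -> U) :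
  discrete_rv (fun w =>
    phi [ffun i => (count_in Y n (T i) w, count_in' Y n m (T i) w)]).
Proof.
exact: discrete_rv_comp (discrete_rv_ffun discrete_class_counts).
Qed.

Lemma measurable_class_errors (phi : (I -> R) -> R) :
  measurable_fun setT (fun w => (phi (fun i => class_error i w))%:E).
Proof.
apply: discrete_rv_measurable.
have := discrete_of_class_counts
  (fun k => (phi (fun i => score H (k i).1 (k i).2))%:E).
congr discrete_rv; apply/funext => w; congr (phi _)%:E.
by apply/funext => i; rewrite ffunE.
Qed.

Lemma class_error_cutoff w :
  \forall L \near \oo, forall i, score (cutoff L H)
    (count_in Y n (T i) w) (count_in' Y n m (T i) w) = class_error i w.
Proof.
near=> L => i; rewrite /class_error /score /cutoff ifT //.
apply: (@leq_trans (n w)); last by near: L; exact: nbhs_infty_ge.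
rewrite /count_in; apply: (@leq_trans (\sum_(0 <= k < n w) 1)%N).
  by apply: leq_sum => k _; exact: leq_b1.
by rewrite sum_nat_const_nat muln1 subn0.
Unshelve. all: by end_near. Qed.

Lemma score_cutoff_sqr_le L N N' :
  score (cutoff L H) N N' ^+ 2 <= score H N N' ^+ 2.
Proof.
rewrite !score_sqr ?cutoff0 // lerD2l /cutoff; case: ifP => // _.
by rewrite expr0n sqr_ge0.
Qed.

Lemma integral_cutoff_sqr L :
  (\int[P]_w (\sum_i score (cutoff L H)
      (count_in Y n (T i) w) (count_in' Y n m (T i) w) ^+ 2)%:E =
   (\sum_i poisson_mean t (r * t) (class_prob q (T i)) L (fun k => H k ^+ 2)%R)%:E)%E.
Proof.
pose phi (x : {ffun K * bool -> 'I_L.+2}) := \sum_i class_score H (T i) x ^+ 2.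
transitivity (\int[P]_w (phi (cell_vector Y n m L w))%:E)%E.
  apply: eq_integral => w _; congr (_%:E); apply: eq_bigr => i _.
  by rewrite class_score_cell_vector.
have phi0 x : 0 <= phi x by apply: sumr_ge0 => i _; exact: sqr_ge0.
rewrite (integral_cell_vector sampling (ltW t0) rt0 phi0).
congr (_%:E); rewrite expect_sum; apply: eq_bigr => i _.
exact: (expect_class_score_sqr sampling L (ltW t0) rt0 H0 (T i)).
Qed.

Section energy.
Hypothesis fin : energy_finite t H.
Hypothesis p01 : forall i, 0 <= class_prob q (T i) <= 1.

(** This is the dominating function for removing the cutoff. The cut off sums
    have bounded integrals, and Fatou's lemma applies. *)
Lemma sum_sqr_integrable :
  P.-integrable setT (fun w => (\sum_i class_error i w ^+ 2)%:E).
Proof.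
apply/integrableP; split.
  exact: (measurable_class_errors (fun e => \sum_i e i ^+ 2)).
have nn (f : I -> R) : (0 <= (\sum_i f i ^+ 2)%:E)%E.
  by rewrite lee_fin; apply: sumr_ge0 => i _; exact: sqr_ge0.
under eq_integral do rewrite gee0_abs //.
apply: (@le_lt_trans _ _
  (\sum_i second_mean r t H (class_prob q (T i)))%:E); last exact: ltry.
have -> : (\int[P]_w (\sum_i class_error i w ^+ 2)%:E =
    \int[P]_w limn_einf (fun L => (\sum_i score (cutoff L H)
      (count_in Y n (T i) w) (count_in' Y n m (T i) w) ^+ 2)%:E))%E.
  apply: eq_integral => w _; apply/esym.
  apply: (cvg_limn_einf_sup _).1; apply: cvg_near_cst.
  have := class_error_cutoff w; apply: filterS => L h; congr (_%:E).
  by apply: eq_bigr => i _; rewrite h.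
apply: le_trans (fatou _ _ _ _) _ => //.
  move=> L; apply: discrete_rv_measurable.
  have := discrete_of_class_counts
    (fun k => (\sum_i score (cutoff L H) (k i).1 (k i).2 ^+ 2)%:E).
  congr discrete_rv; apply/funext => w; congr (_%:E).
  by apply: eq_bigr => i _; rewrite ffunE.
apply: limn_einf_le_cvg (@cvg_cst _ _ _ _ _) => L.
rewrite integral_cutoff_sqr lee_fin; apply: ler_sum => i _.
exact: second_le.
Qed.

(** Dominated convergence from the cut off scores: the square of the sum is at
    most [#|I|] times the sum of the squares. *)
Lemma integral_class_errors_sqr :
    (forall i j a, i != j -> a \in T i -> a \notin T j) ->
  (\int[P]_w ((\sum_i class_error i w) ^+ 2)%:E =
   ((\sum_i bias_mean r t H (class_prob q (T i))) ^+ 2 +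
    \sum_i (second_mean r t H (class_prob q (T i)) -
            bias_mean r t H (class_prob q (T i)) ^+ 2))%R%:E)%E.
Proof.
move=> Tdisj.
pose f L w := (score_sum Y n m L H T w ^+ 2)%:E.
pose g w := ((#|I|%:R * \sum_i class_error i w ^+ 2)%:E : \bar R).
have [|||||_ _] := @dominated_convergence _ _ _ P setT measurableT f
  (fun w => ((\sum_i class_error i w) ^+ 2)%:E) g.
- by move=> L; exact: (measurable_score_sum_sqr sampling).
- exact: (measurable_class_errors (fun e => (\sum_i e i) ^+ 2)).
- apply: aeW => w _; apply: cvg_near_cst.
  have := class_error_cutoff w; apply: filterS => L h; rewrite /f /score_sum.
  by congr (_ ^+ 2)%:E; apply: eq_bigr => i _; rewrite h.
- rewrite /g; under eq_fun do rewrite EFinM.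
  by apply: integrableZl => //; exact: sum_sqr_integrable.
- apply: aeW => w L _; rewrite /f /g gee0_abs ?lee_fin ?sqr_ge0 //.
  apply: le_trans (sqr_sum_le predT _) _.
  rewrite ler_wpM2l //; apply: ler_sum => i _; exact: score_cutoff_sqr_le.
move=> cvf; apply: (cvg_unique (@ereal_hausdorff R) cvf).
pose e1 L i := poisson_mean t (r * t) (class_prob q (T i)) L (fun k => - H k).
pose e2 L i := poisson_mean t (r * t) (class_prob q (T i)) L (fun k => H k ^+ 2).
have -> : [sequence \int[P]_w f L w]_L%E =
    (fun L => ((\sum_i e1 L i) ^+ 2 + \sum_i (e2 L i - e1 L i ^+ 2))%:E).
  apply/funext => L.
  exact: (integral_score_sum_disjoint sampling (ltW t0) rt0 L H0 Tdisj).
apply: cvg_EFin; first exact: nearW.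
apply: cvgD.
  have h : (fun L => \sum_i poisson_mean t (r * t) (class_prob q (T i)) L
      (fun k => - H k)) @ \oo --> \sum_i bias_mean r t H (class_prob q (T i)).
    by apply: cvg_fin_sum => i; exact: mean_cvg.
  exact: (cvgM h h).
apply: cvg_fin_sum => i; apply: cvgB; first exact: second_cvg.
have h := mean_cvg t0 H0 fin (p01 i) (r := r).
exact: (cvgM h h).
Qed.

End energy.

End full_score_sums.

(** This bound needs no summability, and is what shows that the mean square
    error is infinite when the energy is. *)
Lemma integral_class_error_ge d (Om : measurableType d) (R : realType)
    (P : probability Om R) (K : finType) (Y : nat -> Om -> K) (q : K -> R)
    (n m : Om -> nat) (r t : R) (H : nat -> R) (C : {pred K}) (L : nat) :
  poissonized P Y q n m t (r * t) -> 0 < r -> 0 < t -> H 0%N = 0 ->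
  ((poisson_mean t (r * t) (class_prob q C) L (fun k => H k ^+ 2)%R)%:E <=
   \int[P]_w (score H (count_in Y n C w) (count_in' Y n m C w) ^+ 2)%:E)%E.
Proof.
move=> sampling r0 t0 H0; pose T (_ : 'I_1) := C.
have := integral_cutoff_sqr sampling r0 t0 H0 T L; rewrite big_ord1 => <-.
apply: ge0_le_integral => //.
- by move=> w _; rewrite lee_fin; apply: sumr_ge0 => i _; exact: sqr_ge0.
- apply: discrete_rv_measurable.
  have := discrete_of_class_counts sampling T
    (fun k => (\sum_i score (cutoff L H) (k i).1 (k i).2 ^+ 2)%:E).
  congr discrete_rv; apply/funext => w; congr (_%:E).
  by apply: eq_bigr => i _; rewrite ffunE.
- exact: (measurable_class_errors sampling H T (fun e => e ord0 ^+ 2)).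
- by move=> w _; rewrite lee_fin big_ord1; exact: score_cutoff_sqr_le.
Qed.

(** * Lower bounds on the suprema *)

(** The inequality holds for the cut off scores, where both sides are finite
    expectations, and passes to the limit. *)
Lemma bias_mean_sqr_le d (Om : measurableType d) (R : realType)
    (P : probability Om R) (K : finType) (Y : nat -> Om -> K) (q : K -> R)
    (n m : Om -> nat) (r t : R) (H : nat -> R) (C : {pred K}) :
  poissonized P Y q n m t (r * t) -> 0 < r -> 0 < t -> H 0%N = 0 ->
  energy_finite t H -> 0 <= class_prob q C <= 1 ->
  bias_mean r t H (class_prob q C) ^+ 2 <= second_mean r t H (class_prob q C).
Proof.
move=> sampling r0 t0 H0 fin p01; rewrite -subr_ge0.
have rt0 : 0 <= r * t by rewrite mulr_ge0 // ltW.
have h := mean_cvg t0 H0 fin p01 (r := r).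
have cvg : (fun L => poisson_mean t (r * t) (class_prob q C) L (fun k => H k ^+ 2)
    - poisson_mean t (r * t) (class_prob q C) L (fun k => - H k) ^+ 2) @ \oo -->
    second_mean r t H (class_prob q C) - bias_mean r t H (class_prob q C) ^+ 2.
  by apply: cvgB; [exact: second_cvg|exact: (cvgM h h)].
rewrite -(cvg_lim (@Rhausdorff R) cvg); apply: limr_ge; first exact: cvgP cvg.
apply: nearW => L /=; rewrite subr_ge0.
rewrite -(expect_class_score sampling L (ltW t0) rt0 H C).
rewrite -(expect_class_score_sqr sampling L (ltW t0) rt0 H0 C).
by apply: expect_sqr_le => [j v|j]; [exact: trunc_pmf_ge0|exact: trunc_pmf_sum1].
Qed.

Section suprema.
Context (R : realType) (B : nat) (r t : R) (H : nat -> R).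
Hypotheses (B0 : (0 < B)%N) (r0 : 0 < r) (t0 : 0 < t) (H0 : H 0%N = 0).

Let rt0 : 0 < r * t. Proof. exact: mulr_gt0. Qed.

Local Notation D := (bias_mean r t H).
Local Notation D2 := (second_mean r t H).

(** The mean square error of disjoint groups, divided by [B ^ 2]. *)
Definition group_error m (p : 'I_m -> R) : R :=
  (\sum_j D (p j)) ^+ 2 + \sum_j (D2 (p j) - D (p j) ^+ 2).

Lemma class_prob1 (K : finType) (q : K -> R) a : class_prob q (pred1 a) = q a.
Proof. by rewrite /class_prob big_pred1_eq. Qed.

Lemma group_mse m (p : 'I_m -> R) : energy_finite t H ->
  (forall j, 0 <= p j) -> \sum_j p j <= 1 ->
  exists (S : countType) (mu : probability {fset S} R)
    (M : poisson_model mu t (r * t)),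
  [/\ sample_card_le B mu, \sum_j p j = 1 -> sample_nonempty mu,
      mse M H = (B%:R ^+ 2 * group_error p)%:E &
      forall j, D (p j) ^+ 2 <= D2 (p j)].
Proof.
move=> fin p0 p1.
have [mu [M [cB ne law err]]] := group_model_exists t0 rt0 B0 p0 p1.
have sampling := model_sampling M t0 rt0 (@group_of B m).
set q := (fun a : option 'I_m => _) in sampling.
have qE j : class_prob q (pred1 (Some j)) = p j by rewrite class_prob1 /q law.
have p01 j : 0 <= class_prob q (pred1 (Some j)) <= 1.
  rewrite qE p0 /=; apply: le_trans p1; rewrite (bigD1 j) //= lerDl.
  by apply: sumr_ge0.
exists ('I_m * 'I_B)%type, mu, M; split=> //; last first.
  by move=> j; rewrite -qE; exact: bias_mean_sqr_le sampling r0 t0 H0 fin (p01 j).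
pose T (j : 'I_m) : {pred option 'I_m} := pred1 (Some j).
have disj i j a : i != j -> a \in T i -> a \notin T j.
  by move=> ij; rewrite !inE => /eqP ->; apply: contra ij => /eqP [->].
have := integral_class_errors_sqr sampling r0 t0 H0 (T := T) fin p01 disj.
under eq_bigr do rewrite qE; under [X in _ + X]eq_bigr do rewrite qE.
rewrite -/(group_error p) => e; rewrite EFinM -e mseE -ge0_integralZl //.
- apply: eq_integral => w _; rewrite (err H H0 w) -EFinM exprMn.
  by congr (_%:E).
- exact: (measurable_class_errors sampling H T (fun e => (\sum_i e i) ^+ 2)).
- by move=> w _; rewrite lee_fin sqr_ge0.
Qed.

Definition sup_any := sup_mse (fun (S : countType) (mu : probability {fset S} R) =>
  sample_card_le B mu) t (r * t) H.
Definition sup_nonempty := sup_mse (fun (S : countType) (mu : probability {fset S} R) =>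
  sample_nonempty mu /\ sample_card_le B mu) t (r * t) H.

Lemma sup_nonempty_le : (sup_nonempty <= sup_any)%E.
Proof.
apply: ge_ereal_sup => _ [S [mu [M [[_ cB] ->]]]].
by apply: ereal_sup_ubound; exists S, mu, M.
Qed.

Lemma sup_any_ge m (p : 'I_m -> R) : energy_finite t H ->
  (forall j, 0 <= p j) -> \sum_j p j <= 1 ->
  ((B%:R ^+ 2 * group_error p)%:E <= sup_any)%E.
Proof.
move=> fin p0 p1; have [S [mu [M [cB _ e _]]]] := group_mse fin p0 p1.
by apply: ereal_sup_ubound; exists S, mu, M.
Qed.

Lemma sup_nonempty_ge m (p : 'I_m -> R) : energy_finite t H ->
  (forall j, 0 <= p j) -> \sum_j p j = 1 ->
  ((B%:R ^+ 2 * group_error p)%:E <= sup_nonempty)%E.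
Proof.
move=> fin p0 p1; have [|S [mu [M [cB ne e _]]]] := group_mse fin p0 (p := p).
  by rewrite p1.
by apply: ereal_sup_ubound; exists S, mu, M; split=> //; split=> //; exact: ne.
Qed.

(** For one group seen in every sample the score has infinite second moment. *)
Lemma sup_nonempty_infinite : ~ energy_finite t H -> sup_nonempty = +oo%E.
Proof.
move=> infin.
have [||mu [M [cB ne law err]]] := @group_model_exists R t (r * t) B 1 (fun=> 1) t0 rt0 B0.
- by [].
- by rewrite big_ord1.
have sampling := model_sampling M t0 rt0 (@group_of B 1).
set q := (fun a : option 'I_1 => _) in sampling.
have q1 : class_prob q (pred1 (Some ord0)) = 1 by rewrite class_prob1 /q law.
have mse_ge L : ((B%:R ^+ 2 * (expR (- t) *
    partial (coef (fun i => H i ^+ 2) t) L.+1))%:E <= mse M H)%E.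
  have := integral_class_error_ge (pred1 (Some ord0)) L sampling r0 t0 H0.
  rewrite q1 poisson_meanE ?H0 ?expr0n // mulr1 mul1r => h.
  have -> : mse M H = ((B%:R ^+ 2)%:E * \int[pm_P M]_w
      (class_error (fun i w => group_of (pm_X M i w)) (pm_n M) (pm_m M) H
        (fun j : 'I_1 => pred1 (Some j)) ord0 w ^+ 2)%:E)%E.
    rewrite mseE -ge0_integralZl //.
    - apply: eq_integral => w _; rewrite (err H H0 w) big_ord1 -EFinM exprMn.
      by congr (_%:E).
    - exact: (measurable_class_errors sampling H _ (fun e => e ord0 ^+ 2)).
    - by move=> w _; rewrite lee_fin sqr_ge0.
  rewrite EFinM; apply: lee_wpmul2l; first by rewrite lee_fin sqr_ge0.
  apply: le_trans h; rewrite lee_fin ler_wpM2l ?expR_ge0 // lerDr subr_ge0.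
  by rewrite -expR0 ler_expR oppr_le0 mulr_ge0 // ltW.
have sup_ge L : ((B%:R ^+ 2 * (expR (- t) *
    partial (coef (fun i => H i ^+ 2) t) L.+1))%:E <= sup_nonempty)%E.
  apply: le_trans (mse_ge L) _; apply: ereal_sup_ubound.
  exists ('I_1 * 'I_B)%type, mu, M; split=> //; split=> //.
  by apply: ne; rewrite big_ord1.
have c0 : 0 < B%:R ^+ 2 * expR (- t).
  by rewrite mulr_gt0 ?expR_gt0 // exprn_gt0 // ltr0n.
move: sup_ge; case: sup_nonempty => [y|//|] sup_ge; last by have := sup_ge 0%N.
exfalso; apply: infin; apply: (energy_finite_bounded t0 (C := y / (B%:R ^+ 2 * expR (- t)))).
move=> n; rewrite ler_pdivlMr // mulrC -mulrA; have := sup_ge n; rewrite lee_fin.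
apply: le_trans; rewrite ler_wpM2l ?sqr_ge0 // ler_wpM2l ?expR_ge0 //.
apply: partial_le => // i; apply: coef_ge0 (ltW t0) => k; exact: sqr_ge0.
Qed.

Lemma bias_mean_sqr_le_second p : energy_finite t H -> 0 <= p <= 1 ->
  D p ^+ 2 <= D2 p.
Proof.
move=> fin /andP[p0 p1].
have [|_ [_ [_ [_ _ _ /(_ ord0)]]]] // := @group_mse 1 (fun=> p) fin (fun=> p0).
by rewrite big_ord1.
Qed.

Section finite_supremum.
Hypothesis fin : energy_finite t H.

(** The hypotheses exclude [p = 0], where the functional uses the limits. *)
Lemma functional_le Cb Cv : 0 <= Cb ->
  (forall p, 0 < p <= 1 -> `|D p| <= p * Cb) ->
  (forall p, 0 < p <= 1 -> D2 p <= p * Cv) ->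
  (G_fun r t H <= (Cb ^+ 2 + Cv)%:E)%E.
Proof.
move=> Cb0 hb hv; rewrite /G_fun ifF; last exact/negbTE/fin.
rewrite EFinD; apply: leeD; last first.
  apply: ge_ereal_sup => _ [q /= + <-]; rewrite in_itv /= => /andP[q0 q1].
  rewrite lee_fin; have [->|qn0] := eqVneq q 0.
    by rewrite /var_at eqxx; exact: var_at_zero r0 t0 fin _ hv.
  have qp : 0 < q by rewrite lt_neqAle eq_sym qn0.
  by rewrite var_atE // ler_pdivrMr // mulrC hv // qp.
have sup_le : (ereal_sup [set (bias_at r t H p)%:E | p in `[0%R, 1%R]] <= Cb%:E)%E.
  apply: ge_ereal_sup => _ [q /= + <-]; rewrite in_itv /= => /andP[q0 q1].
  rewrite lee_fin; have [->|qn0] := eqVneq q 0.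
    by rewrite /bias_at eqxx; exact: bias_at_zero r0 t0 fin _ hb.
  have qp : 0 < q by rewrite lt_neqAle eq_sym qn0.
  by rewrite bias_atE // ler_pdivrMr // mulrC hb // qp.
have sup_ge : (0 <= ereal_sup [set (bias_at r t H p)%:E | p in `[0%R, 1%R]])%E.
  apply: (@le_trans _ _ (bias_at r t H 0)%:E).
    by rewrite lee_fin /bias_at eqxx mulr_ge0 // ltW.
  by apply: ereal_sup_ubound; exists 0 => //=; rewrite in_itv /= lexx ler01.
rewrite /Y_b; move: sup_le sup_ge; case: (ereal_sup _) => // x.
rewrite !lee_fin => xC x0; rewrite -expr2.
by rewrite lerXn2r.
Qed.

Context (M : R).

(** [k] is the integral part of [1 / p]. *)
Lemma floor_multiple (p : R) : 0 < p <= 1 ->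
  exists k : nat, [/\ (0 < k)%N, k%:R * p <= 1 & 1 < 2 * (k%:R * p)].
Proof.
move=> /andP[p0 p1]; have pV : 0 <= p^-1 by rewrite invr_ge0 ltW.
have /andP[k1 k2] := truncn_itv pV; set k := Num.truncn _ in k1 k2.
have p1' : 1 <= p^-1 by rewrite invf_ge1.
have k0 : (0 < k)%N.
  rewrite lt0n; apply/eqP => e; move: k2; rewrite e => k2.
  by have := le_lt_trans p1' k2; rewrite ltxx.
exists k; split=> //; first by rewrite -ler_pdivlMr // div1r.
move: k2; rewrite -div1r ltr_pdivrMr // -natr1 => k2.
have : 1 <= k%:R :> R by rewrite ler1n.
nra.
Qed.

Lemma group_error_const k p : group_error (fun _ : 'I_k => p) =
  (k%:R * D p) ^+ 2 + k%:R * (D2 p - D p ^+ 2).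
Proof. by rewrite /group_error !sumr_const card_ord !mulr_natl. Qed.

(** Here [b(p)^2 <= 4 M] and [v(p) <= 2 M] because [2 k p > 1]. *)
Lemma functional_le_any :
  (forall k (p : 'I_k -> R), (forall j, 0 <= p j) -> \sum_j p j <= 1 ->
     group_error p <= M) ->
  (G_fun r t H <= (6 * M)%:E)%E.
Proof.
move=> hM.
have key p : 0 < p <= 1 -> exists k : nat, [/\ (0 < k)%N, 1 < 2 * (k%:R * p),
    (k%:R * D p) ^+ 2 <= M & k%:R * D2 p <= M].
  move=> p01; have [k [k0 kp1 kp2]] := floor_multiple p01.
  have /andP[p0 p1] := p01; exists k; split=> //.
    have := hM k (fun=> p) (fun=> ltW p0); rewrite sumr_const card_ord -[p *+ k]mulr_natl.
    move=> /(_ kp1); rewrite group_error_const; apply: le_trans; rewrite lerDl.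
    by rewrite mulr_ge0 // subr_ge0 bias_mean_sqr_le_second // p1 ltW.
  have := hM k (fun=> p) (fun=> ltW p0); rewrite sumr_const card_ord -[p *+ k]mulr_natl.
  move=> /(_ kp1); rewrite group_error_const; apply: le_trans.
  have : 0 <= (k%:R - 1) * k%:R * D p ^+ 2.
    by rewrite mulr_ge0 ?sqr_ge0 // mulr_ge0 // subr_ge0 ler1n.
  nra.
have M0 : 0 <= M.
  by have [|k [_ _ h _]] := key 1; [rewrite ltr01 lexx|exact: le_trans (sqr_ge0 _) h].
have -> : 6 * M = (2 * Num.sqrt M) ^+ 2 + 2 * M.
  by rewrite exprMn sqr_sqrtr //; ring.
apply: functional_le => [|p p01|p p01]; first by rewrite mulr_ge0 // sqrtr_ge0.
  have [k [k0 kp hb _]] := key p p01.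
  have kR : 0 < k%:R :> R by rewrite ltr0n.
  have hb' : k%:R * `|D p| <= Num.sqrt M.
    by rewrite -(ger0_norm (ltW kR)) -normrM -sqrtr_sqr ler_wsqrtr.
  rewrite -(ler_pM2l kR); apply: (le_trans hb').
  have := sqrtr_ge0 M; nra.
have [k [k0 kp _ hv]] := key p p01.
have kR : 0 < k%:R :> R by rewrite ltr0n.
rewrite -(ler_pM2l kR); apply: (le_trans hv); nra.
Qed.

Lemma group_error_ge k (p : 'I_k -> R) : (forall j, 0 <= p j <= 1) ->
  (\sum_j D (p j)) ^+ 2 <= group_error p /\
  \sum_j (D2 (p j) - D (p j) ^+ 2) <= group_error p.
Proof.
move=> p01; split; first rewrite lerDl; last by rewrite lerDr sqr_ge0.
by apply: sumr_ge0 => j _; rewrite subr_ge0 bias_mean_sqr_le_second.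
Qed.

(** The constant is [3 ^ 2 + 11 = 20], from [sup |b| <= 3 sqrt M] and
    [v(p) <= 11 M]. *)
Lemma functional_le_nonempty :
  (forall k (p : 'I_k -> R), (forall j, 0 <= p j) -> \sum_j p j = 1 ->
     group_error p <= M) ->
  (G_fun r t H <= (34 * M)%:E)%E.
Proof.
move=> hM; set b := Num.sqrt M.
have both k (p : 'I_k -> R) : (forall j, 0 <= p j) -> \sum_j p j = 1 ->
    `|\sum_j D (p j)| <= b /\ \sum_j (D2 (p j) - D (p j) ^+ 2) <= M.
  move=> p0 p1; have p01 j : 0 <= p j <= 1.
    rewrite p0 -p1 (bigD1 j) //= lerDl; exact: sumr_ge0.
  have [h1 h2] := group_error_ge p01; have hp := hM k p p0 p1.
  split; last exact: le_trans hp.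
  by rewrite -sqrtr_sqr ler_wsqrtr // (le_trans h1).
have b0 : 0 <= b by exact: sqrtr_ge0.
(* The last group has index [k] and carries the remaining probability. *)
have mixed k p : 0 <= p -> k%:R * p <= 1 ->
    `|k%:R * D p + D (1 - k%:R * p)| <= b /\ k%:R * (D2 p - D p ^+ 2) <= M.
  move=> p0 kp; pose f (j : 'I_k.+1) := if (j < k)%N then p else 1 - k%:R * p.
  have fk (F : R -> R) : \sum_j F (f j) = k%:R * F p + F (1 - k%:R * p).
    rewrite big_ord_recr /= /f /= ltnn; congr (_ + _).
    rewrite (eq_bigr (fun=> F p)) => [|j _]; last by rewrite /= ltn_ord.
    by rewrite sumr_const card_ord mulr_natl.
  have f0 j : 0 <= f j by rewrite /f; case: ifP => // _; rewrite subr_ge0.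
  have [|h1 h2] := both _ f f0; first by rewrite (fk id) addrC subrK.
  rewrite (fk D) in h1; rewrite (fk (fun x => D2 x - D x ^+ 2)) in h2.
  split=> //; apply: le_trans h2; rewrite lerDl subr_ge0.
  apply: bias_mean_sqr_le_second => //.
  by rewrite subr_ge0 kp gerBl mulr_ge0.
have M0 : 0 <= M.
  by have [|_] := mixed 0%N 0 (lexx 0); rewrite !mul0r.
have bE : b ^+ 2 = M by rewrite sqr_sqrtr.
(* [s] is the supremum of [|b|]; it is finite by [bias_mean_bounded]. *)
pose E := [set `|D p| / p | p in [set p : R | 0 < p <= 1]].
have ubE : has_ubound E.
  exists (r * t + abs_total t H) => _ [p /= /andP[p0 p1] <-].
  rewrite ler_pdivrMr // mulrC; apply: (bias_mean_bounded r0 t0 fin).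
  by rewrite ltW.
have supE : has_sup E by split=> //; exists (`|D 1| / 1); exists 1 => //=; lra.
pose s := sup E.
have Ds p : 0 <= p <= 1 -> `|D p| <= p * s.
  move=> /andP[p0 p1]; have [->|pn0] := eqVneq p 0.
    by rewrite mul0r -[leRHS](mul0r (r * t + abs_total t H));
      apply: (bias_mean_bounded r0 t0 fin); rewrite lexx ler01.
  have pp : 0 < p by rewrite lt_neqAle eq_sym pn0.
  rewrite mulrC -ler_pdivrMr //; apply: ub_le_sup => //.
  by exists p => //=; rewrite pp.
have improve p : 0 < p <= 1 -> exists k : nat, [/\ 0 < k%:R * p, k%:R * p <= 1,
    1 < 2 * (k%:R * p), k%:R * (D2 p - D p ^+ 2) <= M &
    2 * (k%:R * `|D p|) <= 3 * b + (2 * (k%:R * p) - 1) * s].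
  move=> p01; have [k [k0 kp1 kp2]] := floor_multiple p01.
  have /andP[p0 p1] := p01; have kp0 : 0 < k%:R * p by rewrite mulr_gt0 // ltr0n.
  have [h1 h2] := mixed k p (ltW p0) kp1.
  set u := k%:R * p in kp0 kp1 kp2 h1 *.
  have q0 : 0 <= 1 - u by lra.
  have q1 : 2 * (1 - u) <= 1 by lra.
  have [h3 _] := mixed 2 (1 - u) q0 q1.
  have q2 : 0 <= 1 - 2 * (1 - u) <= 1 by apply/andP; split; lra.
  have h4 := Ds _ q2.
  exists k; split=> //.
  have a1 : k%:R * `|D p| <= b + `|D (1 - u)|.
    rewrite -[X in X * _](ger0_norm (ler0n R k)) -normrM.
    rewrite -(addrK (D (1 - u)) (k%:R * D p)); apply: (le_trans (ler_normB _ _)).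
    by rewrite lerD2r.
  have a2 : 2 * `|D (1 - u)| <= b + `|D (1 - 2 * (1 - u))|.
    rewrite -[X in X * _](ger0_norm (ler0n R 2)) -normrM.
    rewrite -(addrK (D (1 - 2 * (1 - u))) (2 * D (1 - u))).
    by apply: (le_trans (ler_normB _ _)); rewrite lerD2r.
  rewrite -/u; have -> : (2 * u - 1) * s = (1 - 2 * (1 - u)) * s by ring.
  lra.
have s3 : s <= 3 * b.
  rewrite leNgt; apply/negP => bs.
  (* A supremum above [3 * b] would be improved by half of the excess. *)
  suff : s <= s - (s - 3 * b) / 2 by lra.
  apply: ge_sup; first by case: supE.
  move=> _ [p /= p01 <-]; have [k [u0 u1 u2 _ h]] := improve p p01.
  have /andP[p0 p1] := p01; rewrite ler_pdivrMr //.
  have k0 : 0 < k%:R :> R.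
    by move: u0; rewrite pmulr_lgt0.
  rewrite -(ler_pM2l k0).
  have -> : k%:R * ((s - (s - 3 * b) / 2) * p) =
      k%:R * p * (s - (s - 3 * b) / 2) by ring.
  have : 0 <= (s - 3 * b) * (1 - k%:R * p) by rewrite mulr_ge0 // subr_ge0 // ltW.
  move: h; move: (k%:R * p) (k%:R * `|D p|) => u v; lra.
have DB p : 0 < p <= 1 -> `|D p| <= p * (3 * b).
  move=> /andP[p0 p1]; apply: le_trans (Ds p _) _; first by rewrite ltW.
  by rewrite ler_pM2l.
have DV p : 0 < p <= 1 -> D2 p <= p * (11 * M).
  move=> p01; have [k [u0 u1 u2 h _]] := improve p p01.
  have /andP[p0 p1] := p01.
  have k0 : 0 < k%:R :> R by move: u0; rewrite pmulr_lgt0.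
  have d2 : D p ^+ 2 <= p * (9 * M).
    rewrite -[leLHS]real_normK ?num_real //.
    apply: (@le_trans _ _ ((p * (3 * b)) ^+ 2)).
      by rewrite lerXn2r ?nnegrE ?normr_ge0 ?mulr_ge0 ?(ltW p0) // DB.
    rewrite exprMn exprMn bE expr2 -mulrA ler_pM2l //.
    have -> : (3 : R) ^+ 2 = 9 by ring.
    by rewrite ler_piMl // mulr_ge0.
  rewrite -(ler_pM2l k0).
  have : k%:R * D p ^+ 2 <= k%:R * (p * (9 * M)) by rewrite ler_pM2l.
  have : M <= k%:R * p * 2 * M by rewrite ler_peMl // mulrC ltW.
  move: h; rewrite mulrBr; lra.
apply: le_trans (functional_le _ DB DV) _; first by rewrite mulr_ge0.
rewrite lee_fin exprMn bE.
have -> : (3 : R) ^+ 2 = 9 by ring.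
lra.
Qed.

End finite_supremum.

End suprema.

(** * Comparison of the two estimators *)

Section comparison.
Context (R : realType) (B : nat) (r t : R).
Hypotheses (B0 : (0 < B)%N) (r0 : 0 < r) (t0 : 0 < t).

Lemma second_mean0 H : second_mean r t H 0 = 0.
Proof.
have -> : second_mean r t H 0 = limn (partial (coef (fun i => H i ^+ 2) (0 * t))).
  by rewrite /second_mean mulr0 !mul0r oppr0 expR0 subrr add0r mul1r.
rewrite (_ : partial _ = fun=> 0) ?lim_cst //.
apply/funext => n; rewrite /partial big_nat_cond big1 // => i /andP[/andP[i0 _] _].
by rewrite /coef mul0r expr0n gtn_eqF // mulr0.
Qed.

(** [Y_b] and [Y_v] are nonnegative, so both are finite when the functional is. *)
Lemma mse_le_functional H g : H 0%N = 0 -> (G_fun r t H <= g%:E)%E ->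
  forall (S : countType) (mu : probability {fset S} R)
    (M : poisson_model mu t (r * t)), sample_card_le B mu ->
  (mse M H <= (B%:R ^+ 2 * g)%:E)%E.
Proof.
move=> H0; rewrite /G_fun; case: ifPn => [_|fin]; first by rewrite leye_eq.
move=> Gg S mu M muB; move: Gg.
have b0 : (0 <= ereal_sup [set (bias_at r t H p)%:E | p in `[0%R, 1%R]])%E.
  apply: (@le_trans _ _ (bias_at r t H 0)%:E).
    by rewrite lee_fin /bias_at eqxx mulr_ge0 // ltW.
  by apply: ereal_sup_ubound; exists 0 => //=; rewrite in_itv /= lexx ler01.
have v0 : (0 <= Y_v r t H)%E.
  apply: (@le_trans _ _ (var_at r t H 0)%:E).
    by rewrite lee_fin /var_at eqxx mulr_ge0 ?(ltW t0) // addr_ge0 ?sqr_ge0 // ltW.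
  by apply: ereal_sup_ubound; exists 0 => //=; rewrite in_itv /= lexx ler01.
have bub p : 0 < p <= 1 -> ((bias_at r t H p)%:E <=
    ereal_sup [set (bias_at r t H p)%:E | p in `[0%R, 1%R]])%E.
  move=> /andP[p0 p1]; apply: ereal_sup_ubound; exists p => //=.
  by rewrite in_itv /= p1 ltW.
have vub p : 0 < p <= 1 -> ((var_at r t H p)%:E <= Y_v r t H)%E.
  move=> /andP[p0 p1]; apply: ereal_sup_ubound; exists p => //=.
  by rewrite in_itv /= p1 ltW.
move: b0 v0 bub vub; rewrite /Y_b.
case: (ereal_sup _) => [yb||] //; case: (Y_v r t H) => [yv||] //;
  rewrite ?lee_fin => yb0 yv0 bub vub // yg.
have zero_or (p : R) : 0 <= p <= 1 -> p = 0 \/ 0 < p <= 1.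
  move=> /andP[p0 p1]; have [->|pn0] := eqVneq p 0; first by left.
  by right; rewrite p1 lt_neqAle eq_sym pn0 p0.
have hb p : 0 <= p <= 1 -> `|bias_mean r t H p| <= p * yb.
  case/zero_or => [->|p01].
    rewrite mul0r -[leRHS](mul0r (r * t + abs_total t H)).
    by apply: (bias_mean_bounded r0 t0 fin); rewrite lexx ler01.
  have /andP[p0 _] := p01; have := bub p p01.
  by rewrite lee_fin bias_atE // ler_pdivrMr // mulrC.
have hv p : 0 <= p <= 1 -> second_mean r t H p <= p * yv.
  case/zero_or => [->|p01]; first by rewrite mul0r second_mean0.
  have /andP[p0 _] := p01; have := vub p p01.
  by rewrite lee_fin var_atE // ler_pdivrMr // mulrC.
apply: (le_trans (mse_upper M r0 t0 H0 fin muB yb0 yv0 hb hv)).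
by rewrite lee_fin ler_wpM2l // sqr_ge0.
Qed.

Context (Hstar H : nat -> R) (H0 : H 0%N = 0).
Hypothesis minimizer : G_minimizer r t Hstar.

(** The upper bound for the minimizer applies to every sample of at most [B]
    species; [Q] enters through the lower bound on the supremum for [H]. *)
Lemma sup_comparison (Q : forall S : countType, probability {fset S} R -> Prop)
    (c : R) :
    0 < c -> (forall (S : countType) (mu : probability {fset S} R), Q S mu -> sample_card_le B mu) ->
    (sup_mse Q t (r * t) H != -oo)%E ->
    (forall s, (sup_mse Q t (r * t) H = s%:E)%E ->
      (G_fun r t H <= (c * (s / B%:R ^+ 2))%:E)%E) ->
  (sup_mse Q t (r * t) Hstar <= c%:E * sup_mse Q t (r * t) H)%E.
Proof.
move=> c0 QB; have [Hs0 Hmin] := minimizer.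
case E : (sup_mse Q t (r * t) H) => [s| |] // _ hG; last first.
  by rewrite gt0_muley ?lte_fin // leey.
have Gs := le_trans (Hmin H H0) (hG s erefl).
apply: ge_ereal_sup => _ [S [mu [M [QM ->]]]].
apply: (le_trans (mse_le_functional Hs0 Gs M (QB _ _ QM))).
rewrite -EFinM lee_fin mulrCA [B%:R ^+ 2 * _]mulrC divfK //.
by rewrite expf_neq0 // pnatr_eq0 -lt0n.
Qed.

Lemma group_error_le s m (p : 'I_m -> R) :
  ((B%:R ^+ 2 * group_error r t H p)%:E <= s%:E)%E ->
  group_error r t H p <= s / B%:R ^+ 2.
Proof.
by rewrite lee_fin ler_pdivlMr ?exprn_gt0 ?ltr0n // mulrC.
Qed.

Lemma sup_nonempty_neqNy : (sup_nonempty B r t H != -oo)%E.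
Proof.
have [fin|infin] := pselect (energy_finite t H); last first.
  by rewrite (sup_nonempty_infinite B0 r0 t0 H0 infin).
have := @sup_nonempty_ge R B r t H B0 r0 t0 H0 1 (fun=> 1) fin (fun=> ler01).
by rewrite big_ord1 => /(_ erefl); case: sup_nonempty.
Qed.

Lemma comparison_any : (sup_any B r t Hstar <= 6%:E * sup_any B r t H)%E.
Proof.
apply: (@sup_comparison (fun S mu => sample_card_le B mu)) => // [|s e].
  rewrite -/(sup_any B r t H); apply: contraNneq sup_nonempty_neqNy => e.
  by rewrite -leeNy_eq -e; exact: sup_nonempty_le.
have [fin|infin] := pselect (energy_finite t H); last first.
  have := sup_nonempty_le B r t H; rewrite (sup_nonempty_infinite B0 r0 t0 H0 infin).
  by rewrite /sup_any e.
apply: (functional_le_any B0 r0 t0 H0 fin) => k p p0 p1; apply: group_error_le.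
by rewrite -e; exact: sup_any_ge.
Qed.

Lemma comparison_nonempty :
  (sup_nonempty B r t Hstar <= 34%:E * sup_nonempty B r t H)%E.
Proof.
apply: (@sup_comparison (fun S mu => sample_nonempty mu /\ sample_card_le B mu))
  => // [S mu [] //||s e]; first exact: sup_nonempty_neqNy.
have [fin|infin] := pselect (energy_finite t H); last first.
  by have := sup_nonempty_infinite B0 r0 t0 H0 infin; rewrite /sup_nonempty e.
apply: (functional_le_nonempty B0 r0 t0 H0 fin) => k p p0 p1; apply: group_error_le.
by rewrite -e; exact: sup_nonempty_ge.
Qed.

End comparison.

Theorem corollary22 (R : realType) (B : nat) (r t : R) (Hstar : nat -> R)
    (hB : (1 <= B)%N) (hr : 0 < r) (ht : 0 < t)
    (hHstar : G_minimizer r t Hstar)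
    (H : nat -> R) (hH : H 0%N = 0) :
  (sup_mse (fun (S : countType) (mu : probability {fset S} R) =>
              sample_card_le B mu) t (r * t) Hstar
   <= 6%:E *
     sup_mse (fun (S : countType) (mu : probability {fset S} R) =>
              sample_card_le B mu) t (r * t) H)%E /\
  (sup_mse (fun (S : countType) (mu : probability {fset S} R) =>
              sample_nonempty mu /\ sample_card_le B mu) t (r * t) Hstar
   <= 34%:E *
     sup_mse (fun (S : countType) (mu : probability {fset S} R) =>
              sample_nonempty mu /\ sample_card_le B mu) t (r * t) H)%E.
Proof.
split; first exact: (comparison_any hB hr ht hH hHstar).
exact: (comparison_nonempty hB hr ht hH hHstar).
Qed.
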